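(* There are absolute constants $d_0, C_1, C_1', C_2>0$ such that the following holds. Let $\Sigma$ be a $d$-regular bipartite graph on $N$ vertices with bipartite expansion $\delta$ and locality $\ell>0$ satisfying $$\delta \geq \max\left\{\frac{C_1\log^3 d}{d},\frac{C_1'\log d}{\ell}\right\}$$ and with $d\geq d_0$. If the Glauber dynamics chain $\mathcal{M}_3(\Sigma)$ is ergodic, then $$\tau_{\mathcal{M}_3(\Sigma)} \geq 2^{\,C_2N\delta/\log d}.$$
   Context: All graphs are finite, simple and loopless. $\log=\log_2$. Let $\Sigma=(V,E)$ be a $d$-regular bipartite graph with partition classes $\mathcal{E}$ and $\mathcal{O}$. For $u,v\in V$ write $u\sim v$ if $u,v$ are adjacent; $N(u)=\{w\in V: w\sim u\}$ and $N(A)=\bigcup_{w\in A}N(w)$ for $A\subseteq V$. For $A\subseteq\mathcal{E}$ (or $A\subseteq\mathcal{O}$) set $[A]=\{x\in V: N(x)\subseteq N(A)\}$, and call $A$ small if $|[A]|\leq |V|/4$. The bipartite expansion of $\Sigma$ is $$\delta(\Sigma)=\min\left\{\frac{|N(A)|-|[A]|}{|N(A)|}: A\subseteq\mathcal{E}\ (\text{or } A\subseteq\mathcal{O}),\ A \text{ small},\ A\neq\emptyset\right\}.$$ The locality $\ell(\Sigma)$ is the largest $\ell\geq 0$ such that for all adjacent $x\sim y$ in $V$ and all independent sets $I$ in the subgraph of $\Sigma$ induced by $N(x)\cup N(y)$ we have $|I|\leq 2d-\ell$. $\mathcal{C}_3=\mathcal{C}_3(\Sigma)$ is the set of proper $3$-colourings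 $\chi:V\to\{0,1,2\}$, and $\pi_3$ is the uniform distribution on $\mathcal{C}_3$. Glauber dynamics $\mathcal{M}_3(\Sigma)$ is the Markov chain on $\mathcal{C}_3$ with transition probabilities $P_3(\chi_1,\chi_2)=0$ if $\chi_1,\chi_2$ differ on more than one vertex, $P_3(\chi_1,\chi_2)=\frac{1}{3|V|}$ if they differ on exactly one vertex, and $P_3(\chi_1,\chi_1)=1-\sum_{\chi'\neq\chi_1}P_3(\chi_1,\chi')$. Ergodic means irreducible and aperiodic; when ergodic, its stationary distribution is $\pi_3$. Its mixing time is $\tau_{\mathcal{M}_3}=\min\{t: d_{TV}(P_3^t,\pi_3)\leq 1/e\}$, where $P_3^t$ is the $t$-step transition probability and $d_{TV}(P_3^t,\pi_3)=\max_{\chi_1\in\mathcal{C}_3}\frac12\sum_{\chi_2\in\mathcal{C}_3}|P_3^t(\chi_1,\chi_2)-\pi_3(\chi_2)|$. *)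

(* Defs.v *)
From mathcomp Require Import all_boot all_order all_algebra.
From mathcomp Require Import reals sequences exp.

Set Implicit Arguments.
Unset Strict Implicit.
Unset Printing Implicit Defensive.

Import Order.TTheory GRing.Theory Num.Theory.
Local Open Scope ring_scope.

(* A finite graph is a relation e on a finType T, subject to simple_graph. *)

Section Graphs.
Variables (T : finType) (e : rel T).

Definition simple_graph : Prop := symmetric e /\ irreflexive e.

Definition nbhd (u : T) : {set T} := [set w | e w u].

Definition nbhds (A : {set T}) : {set T} := \bigcup_(w in A) nbhd w.

Definition regular_graph (d : nat) : Prop := forall u : T, #|nbhd u| = d.

Definition bipartition (E O : {set T}) : Prop :=
  [/\ E :|: O = [set: T], [disjoint E & O]
    & forall u v : T, e u v ->
        (u \in E) && (v \in O) || (u \in O) && (v \in E)].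

Definition nbhd_closure (A : {set T}) : {set T} :=
  [set x | nbhd x \subset nbhds A].

(* |[A]| <= |V| / 4, cleared of the division *)
Definition small_set (A : {set T}) : bool := (4 * #|nbhd_closure A| <= #|T|)%N.

Definition independent (I : {set T}) : Prop :=
  {in I &, forall u v : T, ~~ e u v}.

(* |I| <= 2 d - l, written without truncated subtraction *)
Definition local_at (d l : nat) : Prop :=
  forall x y : T, e x y ->
  forall I : {set T}, I \subset nbhd x :|: nbhd y -> independent I ->
    (#|I| + l <= 2 * d)%N.

(* l is the locality of the d-regular graph e.  Relational, because there is
   no largest l when e has no edge.  Since the |I| are integers, the largest
   real l is the largest natural one. *)
Definition is_locality (d l : nat) : Prop :=
  local_at d l /\ forall l' : nat, local_at d l' -> (l' <= l)%N.

Definition expansion_test_set (E O A : {set T}) : Prop :=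
  [/\ (A \subset E) || (A \subset O), small_set A & A != set0].

Section Expansion.
Variable R : realType.

Definition expansion_ratio (A : {set T}) : R :=
  (#|nbhds A|%:R - #|nbhd_closure A|%:R) / #|nbhds A|%:R.

(* Relational, because a graph may have no nonempty small set (for instance
   the complete bipartite graph K_{d,d}), so that the minimum is undefined. *)
Definition is_bipartite_expansion (E O : {set T}) (delta : R) : Prop :=
  (exists2 A, expansion_test_set E O A & delta = expansion_ratio A) /\
  (forall A, expansion_test_set E O A -> delta <= expansion_ratio A).

End Expansion.
End Graphs.

Section MarkovChains.
Variables (R : realType) (S : finType) (P : S -> S -> R).

Fixpoint iter_kernel (t : nat) (x y : S) : R :=
  if t is t'.+1 then \sum_(z : S) P x z * iter_kernel t' z y
  else (x == y)%:R.

Definition irreducible_chain : Prop :=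
  forall x y : S, exists t : nat, 0 < iter_kernel t x y.

(* for every x, the gcd of the return times {t >= 1 : P^t(x,x) > 0} is 1 *)
Definition aperiodic_chain : Prop :=
  forall (x : S) (k : nat),
    (forall t : nat, (0 < t)%N -> 0 < iter_kernel t x x -> (k %| t)%N) ->
    k = 1%N.

Definition ergodic_chain : Prop := irreducible_chain /\ aperiodic_chain.

Definition uniform_distr (_ : S) : R := (#|S|%:R)^-1.

(* max over the starting state; all the terms are nonnegative *)
Definition dTV (t : nat) (mu : S -> R) : R :=
  \big[Num.max/0]_(x : S)
    (2^-1 * \sum_(y : S) `|iter_kernel t x y - mu y|).

Definition is_mixing_time (mu : S -> R) (tau : nat) : Prop :=
  dTV tau mu <= (expR 1)^-1 /\
  forall t : nat, dTV t mu <= (expR 1)^-1 -> (tau <= t)%N.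

End MarkovChains.

Section Glauber.
Variables (T : finType) (e : rel T).

Definition proper_coloring (c : {ffun T -> 'I_3}) : bool :=
  [forall u, forall v, e u v ==> (c u != c v)].

Definition coloring3 : Type := {c : {ffun T -> 'I_3} | proper_coloring c}.

Definition num_diff (c1 c2 : coloring3) : nat :=
  #|[set v | val c1 v != val c2 v]|.

Variable R : realType.

Definition glauber_move (c1 c2 : coloring3) : R :=
  if num_diff c1 c2 == 1%N then (3 * #|T|%:R)^-1 else 0.

Definition glauber (c1 c2 : coloring3) : R :=
  if c1 == c2 then 1 - \sum_(c | c != c1) glauber_move c1 c
  else glauber_move c1 c2.

End Glauber.

Definition log2 (R : realType) (x : R) : R := ln x / ln 2.

(* Main.v *)
Require Import Defs.
From mathcomp Require Import all_boot all_order all_algebra.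
From mathcomp Require Import reals sequences exp.
From mathcomp Require Import ring lra zify.

(* Let n = |E| = |O|.  The phase of colour a consists of the colourings that
   are equal to a on all but n/20 vertices of E; it contains 2^n colourings, and
   the phases of two colours are disjoint, so one of them has measure at most
   1/2.  It remains to bound its boundary by 2^(n - c delta n), by a container
   argument.

   Certificates.  For a colouring f choose a set S, containing a fixed total
   dominating set of size O(n log d / d) and maximising
   #{u : f takes two values on N(u) /\ S} - psi |S|.  Then S has
   O(n log d / d + n / psi) vertices, so there are few pairs (S, f|_S).  By
   maximality, f(v) is determined by (S, f|_S) unless v sees only one colour in
   S and has at most 3 psi neighbours of that kind.

   Counting with a fixed certificate.  Let F be the set of vertices on which the
   colourings with this certificate do not all agree.  It induces a graph of
   maximum degree at most 3 psi, much less than d, and every v in F avoids the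
   unique colour seen on N(v) \ F.  Let m be the size of a maximal matching in F,
   and W the set of its endpoints.  Then there are at most 2^|F| (3/4)^m
   colourings, and counting edges |F| <= n + O(m psi / d).  Since F \ W is
   independent, expansion gives |F \ W| <= n - delta n / 100 + O(m) unless one
   side is almost entirely coloured with one colour.  Combining the two bounds
   saves a factor 2^(c delta n) whether m is small or large.

   A boundary colouring with an almost monochromatic side is close to a fixed
   colouring constant on both sides, and there are few of these. *)

Set Implicit Arguments.
Unset Strict Implicit.
Unset Printing Implicit Defensive.

Import Order.TTheory GRing.Theory Num.Theory.
Local Open Scope ring_scope.

(** * Regular bipartite graphs and expansion *)

Section RegularGraph.
Variables (T : finType) (e : rel T) (d : nat).
Hypotheses (esym : symmetric e) (ereg : regular_graph e d).

(** Both sides count the adjacent pairs with one member in [A] and the other in [B]. *)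
Lemma sum_degrees (A B : {set T}) :
  (\sum_(x in A) #|nbhd e x :&: B| = \sum_(y in B) #|nbhd e y :&: A|)%N.
Proof.
have cardE (x : T) (C : {set T}) : #|nbhd e x :&: C| = (\sum_(y in C) e y x)%N.
  rewrite -sum1_card big_mkcond [RHS]big_mkcond; apply: eq_bigr => y _.
  by rewrite !inE andbC; case: (y \in C); case: (e y x).
under eq_bigr do rewrite cardE; under [RHS]eq_bigr do rewrite cardE.
by rewrite exchange_big; apply: eq_bigr => y _; apply: eq_bigr => x _; rewrite esym.
Qed.

(** The [d] edges at each vertex of [A] all end in [B], whose vertices absorb at most [d] each. *)
Lemma card_le_of_nbhd_sub (A B : {set T}) :
  (0 < d)%N -> (forall x, x \in A -> nbhd e x \subset B) -> (#|A| <= #|B|)%N.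
Proof.
move=> d_gt0 AB; rewrite -(leq_pmul2r d_gt0).
have -> : (#|A| * d = \sum_(x in A) #|nbhd e x :&: B|)%N.
  rewrite -sum_nat_const; apply: eq_bigr => x xA.
  by rewrite (setIidPl (AB x xA)) ereg.
rewrite sum_degrees -sum_nat_const; apply: leq_sum => y _.
by rewrite -(ereg y) subset_leq_card // subsetIl.
Qed.

Lemma mem_nbhds (A : {set T}) y :
  reflect (exists2 x, x \in A & e x y) (y \in nbhds e A).
Proof.
apply: (iffP bigcupP) => -[x xA]; first by rewrite inE esym; exists x.
by exists x => //; rewrite inE esym.
Qed.

Lemma card_nbhds_ge (A : {set T}) : (0 < d)%N -> (#|A| <= #|nbhds e A|)%N.
Proof.
by move=> d0; apply: card_le_of_nbhd_sub => // x xA; apply: bigcup_sup.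
Qed.

Lemma card_nbhd_closure_le (A : {set T}) :
  (0 < d)%N -> (#|nbhd_closure e A| <= #|nbhds e A|)%N.
Proof. by move=> d0; apply: card_le_of_nbhd_sub => // x; rewrite inE. Qed.

Lemma sub_nbhd_closure (A : {set T}) : A \subset nbhd_closure e A.
Proof. by apply/subsetP => x xA; rewrite inE; apply: bigcup_sup. Qed.

End RegularGraph.

Section Bipartite.
Variables (T : finType) (e : rel T) (d : nat).
Hypotheses (esym : symmetric e) (ereg : regular_graph e d) (d_gt0 : (0 < d)%N).

Lemma bipartitionC (E O : {set T}) : bipartition e E O -> bipartition e O E.
Proof.
case=> EO dEO be; split; rewrite 1?setUC 1?disjoint_sym // => u v /be.
by rewrite orbC.
Qed.

Lemma bipartition_edge (E O : {set T}) u v :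
  bipartition e E O -> e u v -> u \in E -> v \in O.
Proof.
case=> _ dEO be /be /orP[/andP[]//|/andP[uO _] uE].
by move: (disjointFr dEO uE); rewrite uO.
Qed.

Lemma mem_bipartition (E O : {set T}) u :
  bipartition e E O -> (u \in O) = (u \notin E).
Proof.
case=> EO dEO _; have: u \in E :|: O by rewrite EO inE.
rewrite inE; case uE: (u \in E) => //= _.
by apply/negbTE; rewrite (disjointFr dEO uE).
Qed.

Lemma nbhds_bipartition (E O A : {set T}) :
  bipartition e E O -> A \subset E -> nbhds e A \subset O.
Proof.
move=> bip /subsetP AE; apply/subsetP => y /(mem_nbhds esym)[x xA exy].
exact: bipartition_edge bip exy (AE _ xA).
Qed.

Lemma nbhd_closure_bipartition (E O A : {set T}) :
  bipartition e E O -> A \subset E -> nbhd_closure e A \subset E.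
Proof.
move=> bip AE; apply/subsetP => x; rewrite inE => /subsetP xA.
have [y yx] : exists y, y \in nbhd e x.
  by apply/set0Pn; rewrite -card_gt0 ereg.
have yO := subsetP (nbhds_bipartition bip AE) _ (xA _ yx).
by move: yx; rewrite inE => /(bipartition_edge (bipartitionC bip)); exact.
Qed.

Lemma card_bipartition_le (E O : {set T}) :
  bipartition e E O -> (#|E| <= #|O|)%N.
Proof.
move=> bip; apply: (card_le_of_nbhd_sub esym ereg) => // x xE.
apply/subsetP => y; rewrite inE esym => exy; exact: bipartition_edge bip exy xE.
Qed.

Lemma card_bipartition (E O : {set T}) :
  bipartition e E O -> #|O| = #|E| /\ #|T| = (2 * #|E|)%N.
Proof.
move=> bip; have eqEO : #|O| = #|E|.
  by apply/eqP; rewrite eqn_leq !card_bipartition_le //; apply: bipartitionC.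
split=> //; case: bip => EO dEO _.
by rewrite -cardsT -EO cardsU disjoint_setI0 // cards0 subn0 eqEO mul2n addnn.
Qed.

Lemma degree_le_side (E O : {set T}) :
  bipartition e E O -> (0 < #|E|)%N -> (d <= #|E|)%N.
Proof.
move=> bip; rewrite card_gt0 => /set0Pn[x xE].
rewrite -(ereg x) -(card_bipartition bip).1; apply: subset_leq_card.
by apply/subsetP => y; rewrite inE esym => exy; exact: bipartition_edge bip exy xE.
Qed.

Definition no_edge (X Y : {set T}) := forall x y, x \in X -> y \in Y -> ~~ e x y.

Lemma no_edgeC X Y : no_edge X Y -> no_edge Y X.
Proof. by move=> XY y x yY xX; rewrite esym; apply: XY. Qed.

Lemma no_edge_card (E O X Y : {set T}) :
  bipartition e E O -> Y \subset O -> no_edge X Y -> X \subset E ->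
  (#|nbhds e X| + #|Y| <= #|E|)%N.
Proof.
move=> bip YO XY XE; rewrite -(card_bipartition bip).1.
rewrite -cardsUI (_ : nbhds e X :&: Y = set0) ?cards0 ?addn0.
  by apply: subset_leq_card; rewrite subUset (nbhds_bipartition bip).
apply/setP => y; rewrite !inE; apply/negP => /andP[/(mem_nbhds esym)[x xX exy] yY].
by move/negP: (XY _ _ xX yY).
Qed.

Section Expansion.
Variables (R : realType) (E O : {set T}) (delta : R).
Hypotheses (bip : bipartition e E O) (delta_ge0 : 0 <= delta).
Hypothesis expd : forall A, expansion_test_set e E O A -> delta <= expansion_ratio e R A.

(** Since [A] lies in its closure, the ratio bound gives |N(A)| >= |A| + delta |N(A)|, and |N(A)| >=
    |A| finishes. *)
Lemma small_expansion (A : {set T}) :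
  (A \subset E) || (A \subset O) -> small_set e A ->
  #|A|%:R * (1 + delta) <= #|nbhds e A|%:R :> R.
Proof.
move=> AEO sA; have [->|A0] := eqVneq A set0.
  by rewrite cards0 mul0r ler0n.
have := expd (And3 AEO sA A0); rewrite /expansion_ratio.
have N0 : 0 < #|nbhds e A|%:R :> R.
  rewrite ltr0n; apply: leq_trans (card_nbhds_ge esym ereg _ d_gt0).
  by rewrite card_gt0.
rewrite ler_pdivlMr // => h.
have h1 : #|A|%:R <= #|nbhd_closure e A|%:R :> R.
  by rewrite ler_nat; apply: subset_leq_card; apply: sub_nbhd_closure.
have h2 : #|A|%:R <= #|nbhds e A|%:R :> R.
  by rewrite ler_nat; apply: card_nbhds_ge ereg _ _.
have : delta * #|A|%:R <= delta * #|nbhds e A|%:R by rewrite ler_wpM2l.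
lra.
Qed.

(** If [X] is small, [Y] must avoid its expanded neighbourhood, and symmetrically. If neither is
    small, both closures exceed half a side; but the closure of [Y] avoids [nbhds e X], which is at
    least as large as the closure of [X], so the two do not fit into one side. *)
Lemma independent_bound (X Y : {set T}) :
  X \subset E -> Y \subset O -> no_edge X Y ->
  #|X|%:R + #|Y|%:R + delta * Num.min #|X|%:R #|Y|%:R <= #|E|%:R :> R.
Proof.
move=> XE YO XY; have bip' := bipartitionC bip.
have [eqEO eqT] := card_bipartition bip.
have hX := no_edge_card bip YO XY XE.
have hY := no_edge_card bip' XE (no_edgeC XY) YO.
have mX : delta * Num.min #|X|%:R #|Y|%:R <= delta * #|X|%:R.
  by rewrite ler_wpM2l // ge_min lexx.
have mY : delta * Num.min #|X|%:R #|Y|%:R <= delta * #|Y|%:R.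
  by rewrite ler_wpM2l // ge_min lexx orbT.
move: hX hY; rewrite eqEO -!(ler_nat R) !natrD => hX hY.
have [sX|lX] := boolP (small_set e X).
  have := small_expansion _ sX; rewrite XE => /(_ isT); lra.
have [sY|lY] := boolP (small_set e Y).
  have := small_expansion _ sY; rewrite YO orbT => /(_ isT); lra.
exfalso; move: lX lY; rewrite /small_set -!ltnNge eqT => lX lY.
have cXY : no_edge X (nbhd_closure e Y).
  move=> x y xX; rewrite inE => /subsetP yY; apply/negP => exy.
  have /(mem_nbhds esym)[z zY ezx] : x \in nbhds e Y by apply: yY; rewrite inE.
  by move/negP: (XY _ _ xX zY); rewrite esym.
have := no_edge_card bip (nbhd_closure_bipartition bip' YO) cXY XE.
have := card_nbhd_closure_le esym ereg X d_gt0.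
lia.
Qed.

End Expansion.
End Bipartite.

(** * Counting list colourings *)

Lemma exists_other_color (a b : 'I_3) : exists c : 'I_3, (c != a) && (c != b).
Proof.
apply/existsP; rewrite -negb_forall_in; apply/negP => /forallP h.
have : (#|'I_3| <= #|[set a; b]|)%N.
  apply: subset_leq_card; apply/subsetP => x _; rewrite !inE.
  by have := h x; case: (x == a) => //=; case: (x == b).
by rewrite card_ord cards2; case: (_ != _).
Qed.

Section Projections.
Variables (T : finType) (C : {set {ffun T -> 'I_3}}).

(** The filler [ord0] lets restrictions to different sets share one type, so that [nproj] can count
    them as an image. *)
Definition restrict (U : {set T}) (f : {ffun T -> 'I_3}) : {ffun T -> 'I_3} :=
  [ffun v => if v \in U then f v else ord0].

Definition nproj (U : {set T}) : nat := #|[set restrict U f | f in C]|.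

Lemma nproj_full : nproj [set: T] = #|C|.
Proof.
rewrite /nproj card_imset // => f g /ffunP h; apply/ffunP => v.
by have := h v; rewrite !ffunE inE.
Qed.

Lemma nprojU (U V : {set T}) : (nproj (U :|: V) <= nproj U * nproj V)%N.
Proof.
rewrite /nproj -cardsX.
set S := [set restrict (U :|: V) f | f in C].
have inj : {in S &, injective (fun f => (restrict U f, restrict V f))}.
  move=> f g /imsetP[f' _ ->] /imsetP[g' _ ->] [/ffunP hU /ffunP hV].
  apply/ffunP => v; have := hU v; have := hV v; rewrite !ffunE !inE.
  by case: (v \in U); case: (v \in V).
rewrite -(card_in_imset inj); apply: subset_leq_card; apply/subsetP => p.
case/imsetP=> f /imsetP[g gC ->] ->; rewrite inE; apply/andP; split=> /=.
  apply/imsetP; exists g => //; apply/ffunP => v; rewrite !ffunE !inE.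
  by case: (v \in U).
apply/imsetP; exists g => //; apply/ffunP => v; rewrite !ffunE !inE orbC.
by case: (v \in V).
Qed.

Lemma nproj_agree (U : {set T}) :
  (forall f g v, f \in C -> g \in C -> v \in U -> f v = g v) -> (nproj U <= 1)%N.
Proof.
move=> agr; apply/card_le1_eqP => f g /imsetP[f' f'C ->] /imsetP[g' g'C ->].
apply/ffunP => v; rewrite !ffunE; case: ifP => // vU; exact: agr.
Qed.

Lemma nproj1 (c : 'I_3) (v : T) :
  (forall f, f \in C -> f v != c) -> (nproj [set v] <= 2)%N.
Proof.
move=> h; pose k a := [ffun w => if w \in [set v] then a else (ord0 : 'I_3)].
apply: (@leq_trans #|k @: [set~ c]|).
  apply: subset_leq_card; apply/subsetP => _ /imsetP[f fC ->].
  apply/imsetP; exists (f v); first by rewrite !inE h.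
  by apply/ffunP => w; rewrite !ffunE inE; case: eqP => // ->.
by apply: (leq_trans (leq_imset_card _ _)); rewrite cardsC1 card_ord.
Qed.

Lemma nproj2 (c1 c2 : 'I_3) (u v : T) : u != v ->
  (forall f, f \in C -> [/\ f u != c1, f v != c2 & f u != f v]) ->
  (nproj [set u; v] <= 3)%N.
Proof.
move=> uv h.
pose k (p : 'I_3 * 'I_3) :=
  [ffun w => if w == u then p.1 else if w == v then p.2 else (ord0 : 'I_3)].
(* The two lists share a colour [a], and properness rules out the pair [(a, a)]. *)
have [a /andP[a1 a2]] := exists_other_color c1 c2.
set P := setX [set~ c1] [set~ c2] :\ (a, a).
apply: (@leq_trans #|k @: P|).
  apply: subset_leq_card; apply/subsetP => _ /imsetP[f fC ->].
  have [h1 h2 h3] := h _ fC.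
  apply/imsetP; exists (f u, f v).
    rewrite !inE h1 h2 /= andbT xpair_eqE; apply/negP => /andP[/eqP e1 /eqP e2].
    by move: h3; rewrite e1 e2 eqxx.
  apply/ffunP => w; rewrite !ffunE !inE /=; case: eqP => [->|] //=.
  by case: eqP => [->|].
apply: (leq_trans (leq_imset_card _ _)).
have := cardsD1 (a, a) (setX [set~ c1] [set~ c2]).
by rewrite cardsX !cardsC1 !card_ord -/P !inE a1 a2 /=; lia.
Qed.

(* Each matched edge carries at most 3 of the 4 pairs allowed by the two lists,
   since two 2-element subsets of a 3-element set intersect. *)
Lemma matching_bound (e : rel T) (c : T -> 'I_3) (F : {set T}) :
  symmetric e -> irreflexive e ->
  (forall f, f \in C -> proper_coloring e f) ->
  (forall f v, f \in C -> v \in F -> f v != c v) ->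
  exists m k (W : {set T}),
    [/\ W \subset F, #|W| = (2 * m)%N, #|F| = (k + 2 * m)%N,
      no_edge e (F :\: W) (F :\: W) & (nproj F <= 2 ^ k * 3 ^ m)%N].
Proof.
move=> esym eirr prop.
(* Strong induction on the size of [F]: an edge inside [F] joins the matching and its ends are
   removed. *)
elim: {F}_.+1 {-2}F (ltnSn #|F|) => // N IH F FN avoid.
have [/forallP noe|] :=
    boolP [forall u, forall v, (u \in F) ==> (v \in F) ==> ~~ e u v].
  exists 0%N, #|F|, set0; split; rewrite ?sub0set ?cards0 ?muln0 ?addn0 ?setD0 //.
    by move=> u v uF vF; move/forallP: (noe u) => /(_ v); rewrite uF vF.
  (* No edge is left, so the matching is empty; peeling off the vertices one at a time costs a
     factor 2 each. *)
  rewrite expn0 muln1; have: forall f v, f \in C -> v \in F -> f v != c v by [].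
  move: {IH FN avoid noe}F => F; elim: {F}_.+1 {-2}F (ltnSn #|F|) => // M IH F FM avoid.
  have [->|[v vF]] := set_0Vmem F.
    by rewrite cards0; apply: nproj_agree => ? ? ?; rewrite inE.
  rewrite -(setD1K vF) cardsU1 !inE eqxx /= expnD.
  apply: (leq_trans (nprojU _ _)); apply: leq_mul.
    by apply: (@nproj1 (c v)) => f fC; apply: avoid.
  apply: IH; first by move: FM; rewrite (cardsD1 v F) vF; lia.
  by move=> f w fC; rewrite !inE => /andP[_]; apply: avoid.
rewrite negb_forall => /existsP[u]; rewrite negb_forall => /existsP[v].
rewrite !negb_imply => /and4P[uF vF euv _].
have uv : u != v by apply: contraTneq euv => ->; rewrite eirr.
have uvF : [set u; v] \subset F by rewrite subUset !sub1set uF.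
have cF : #|F :\: [set u; v]| = (#|F| - 2)%N.
  by rewrite cardsD (setIidPr uvF) cards2 uv.
have F2 : (2 <= #|F|)%N by have := subset_leq_card uvF; rewrite cards2 uv.
have [||m [k [W [WF Wm Fk noe le]]]] := IH (F :\: [set u; v]).
- by lia.
- by move=> f w fC; rewrite inE => /andP[_]; apply: avoid.
exists m.+1, k, (W :|: [set u; v]); split.
- by rewrite subUset uvF andbT (subset_trans WF) ?subsetDl.
- rewrite cardsU disjoint_setI0 ?cards0 ?cards2 ?uv; first by lia.
  rewrite disjoints_subset (subset_trans WF) //.
  by apply/subsetP => x; rewrite !inE => /andP[].
- by lia.
- by move: noe; rewrite setDDl setUC.
rewrite -{1}(setID F [set u; v]) (setIidPr uvF).
apply: (leq_trans (nprojU _ _)); rewrite expnS mulnCA leq_mul //.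
apply: (@nproj2 (c u) (c v)) => // f fC; split; [exact: avoid|exact: avoid|].
by move/forallP: (prop _ fC) => /(_ u)/forallP/(_ v); rewrite euv.
Qed.

End Projections.

(** * Colourings close to a phase *)

Lemma third_color_unique (p q a b : 'I_3) :
  p != q -> a != p -> a != q -> b != p -> b != q -> a = b.
Proof.
move=> pq ap aq bp bq; apply/eqP/negPn/negP => ab.
have : (#|[set p; q; a; b]| <= #|'I_3|)%N by apply: max_card.
rewrite card_ord -!setUA !cardsU1 cards1 !inE !negb_or.
by rewrite pq ab ![_ == a]eq_sym ![_ == b]eq_sym ap aq bp bq.
Qed.

Definition color_class (T : finType) (S : {set T}) (f : T -> 'I_3) (a : 'I_3) : {set T} :=
  [set x in S | f x == a].

Section NearPhase.
Variables (T : finType) (e : rel T) (d : nat).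
Hypotheses (esym : symmetric e) (ereg : regular_graph e d) (d_gt0 : (0 < d)%N).
Variables (R : realType) (E O : {set T}) (delta : R).
Hypotheses (bip : bipartition e E O) (delta_ge0 : 0 <= delta) (delta_le1 : delta <= 1).
Hypothesis expd : forall A, expansion_test_set e E O A -> delta <= expansion_ratio e R A.

(** Split [Y] by the colour [c]. Parts of different colours have common neighbours only in [W], so
    the vertices of [E] not adjacent to one part include [X] and the neighbours of the rest, up to
    [W]. By [independent_bound], the smaller of the two pieces is then controlled by the defect.
    Hence one colour takes nearly all of [Y], and the neighbours of that part carry this colour
    outside [W]. *)
Lemma near_phase (X Y W : {set T}) (f c : T -> 'I_3) (theta : R) :
  X \subset E -> Y \subset O -> no_edge e X Y ->
  (forall x y, y \in Y -> e x y -> x \in W \/ f x = c y) ->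
  5 * theta <= #|E|%:R ->
  #|X|%:R < theta ->
  #|E|%:R - #|X|%:R - #|Y|%:R + 2 * #|W|%:R < delta * theta ->
  exists a, #|E|%:R - 4 * theta < #|color_class E f a|%:R.
Proof.
move=> XE YO XY hW th5 Xth defect.
have bip' := bipartitionC bip.
have th0 : 0 < theta by apply: le_lt_trans Xth; rewrite ler0n.
have XYn := independent_bound esym ereg d_gt0 bip delta_ge0 expd XE YO XY.
have w0 : 0 <= #|W|%:R :> R by rewrite ler0n.
have mXY : 0 <= delta * Num.min #|X|%:R #|Y|%:R.
  by rewrite mulr_ge0 // le_min !ler0n.
have dth : delta * theta <= theta by rewrite ler_piMl // ltW.
pose Yc a := [set y in Y | c y == a].
have Ycs a : Yc a \subset Y by apply/subsetP => y; rewrite inE => /andP[].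
have split_bound a :
    delta * Num.min #|Yc a|%:R #|Y :\: Yc a|%:R
      <= #|E|%:R - #|X|%:R - #|Y|%:R + 2 * #|W|%:R.
  pose Z := E :\: nbhds e (Yc a).
  have YaO : Yc a \subset O by apply: subset_trans YO.
  have ZYa : no_edge e Z (Yc a).
    move=> x y; rewrite inE => /andP[/negP xN _] yYa; apply/negP => exy.
    by apply: xN; apply/(mem_nbhds esym); exists y; rewrite 1?esym.
  have ZE : Z \subset E by apply: subsetDl.
  have := independent_bound esym ereg d_gt0 bip delta_ge0 expd ZE YaO ZYa.
  have XZ : X :|: nbhds e (Y :\: Yc a) \subset Z :|: W.
    apply/subsetP => x; rewrite !inE => /orP[xX|].
      rewrite (subsetP XE) // andbT; apply/orP; left.
      apply/(mem_nbhds esym) => -[y yYa]; apply/negP.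
      by rewrite esym; apply: XY => //; apply: (subsetP (Ycs a)).
    move=> /(mem_nbhds esym)[y]; rewrite !inE negb_and => /andP[+ yY].
    rewrite yY /= => cy eyx.
    have [xW|fx] : x \in W \/ f x = c y by apply: hW; rewrite 1?esym.
      by rewrite xW orbT.
    have xE : x \in E.
      by apply: (bipartition_edge bip' eyx); apply: (subsetP YO).
    rewrite xE andbT; case xW : (x \in W); rewrite ?orbT // orbF.
    apply/(mem_nbhds esym) => -[z]; rewrite inE => /andP[zY /eqP cz] ezx.
    have [|fx'] : x \in W \/ f x = c z by apply: hW; rewrite 1?esym.
      by rewrite xW.
    by move/eqP: cy; rewrite -fx fx'.
  have disj : X :&: nbhds e (Y :\: Yc a) = set0.
    apply/setP => x; rewrite !inE; apply/negP => /andP[xX].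
    move/(mem_nbhds esym) => [y]; rewrite inE => /andP[_ yY]; apply/negP.
    by rewrite esym; apply: XY.
  have cXZ : (#|X| + #|Y :\: Yc a| <= #|Z| + #|W|)%N.
    apply: (@leq_trans (#|X| + #|nbhds e (Y :\: Yc a)|)%N).
      by rewrite leq_add2l; apply: card_nbhds_ge ereg _ _.
    rewrite -cardsUI disj cards0 addn0 (leq_trans (subset_leq_card XZ)) //.
    by rewrite -cardsUI leq_addr.
  have cY : (#|Yc a| + #|Y :\: Yc a| = #|Y|)%N.
    by rewrite -(cardsID (Yc a) Y) (setIidPr (Ycs a)).
  move: cXZ; rewrite -cY -(ler_nat R) !natrD => cXZ.
  have x0 : 0 <= #|X|%:R :> R by rewrite ler0n.
  (* The two minima differ by at most [#|W|], because the rest of [Y] has at most [#|Z| + #|W|]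
     vertices. *)
  have : delta * Num.min #|Yc a|%:R #|Y :\: Yc a|%:R
         <= delta * Num.min #|Z|%:R #|Yc a|%:R + delta * #|W|%:R.
    rewrite -mulrDr ler_wpM2l // ge_min.
    by case: (leP #|Z|%:R #|Yc a|%:R) => _; [rewrite orbC|]; apply/orP; left; lra.
  have : delta * #|W|%:R <= #|W|%:R by rewrite ler_piMl.
  lra.
have [[a tha]|none] : (exists a, theta <= #|Yc a|%:R) \/ (forall a, #|Yc a|%:R < theta).
  have [/existsP[a ha]|h] := boolP [exists a, theta <= #|Yc a|%:R :> R].
    by left; exists a.
  by right=> a; rewrite ltNge; move: h; rewrite negb_exists => /forallP.
  have cY : (#|Yc a| + #|Y :\: Yc a| = #|Y|)%N.
    by rewrite -(cardsID (Yc a) Y) (setIidPr (Ycs a)).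
  have small : #|Y :\: Yc a|%:R < theta.
    rewrite ltNge; apply/negP => big.
    have : delta * theta <= delta * Num.min #|Yc a|%:R #|Y :\: Yc a|%:R.
      by rewrite ler_wpM2l // le_min tha.
    by have := split_bound a; lra.
  exists a.
  have sub : nbhds e (Yc a) \subset color_class E f a :|: W.
    apply/subsetP => x /(mem_nbhds esym)[y]; rewrite inE => /andP[yY /eqP cy] eyx.
    have xE : x \in E.
      by apply: (bipartition_edge bip' eyx); apply: (subsetP YO).
    rewrite !inE xE; have [->|->] : x \in W \/ f x = c y.
    - by apply: hW; rewrite 1?esym.
    - by rewrite orbT.
    - by rewrite cy eqxx.
  have : (#|Yc a| <= #|color_class E f a| + #|W|)%N.
    apply: leq_trans (card_nbhds_ge esym ereg (Yc a) d_gt0) _.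
    by rewrite (leq_trans (subset_leq_card sub)) // -cardsUI leq_addr.
  rewrite -(ler_nat R) natrD; move: cY => /(congr1 (fun k => k%:R : R)).
  rewrite natrD; lra.
(* Three classes below [theta] give [#|Y|] < 3 [theta], whereas the defect bound gives [#|Y|] >
   [#|E|] - 2 [theta] >= 3 [theta]. *)
exfalso.
have : (#|Y| <= \sum_(a : 'I_3) #|Yc a|)%N.
  rewrite -sum1_card (partition_big c predT) //=; apply: leq_sum => a _.
  by rewrite -sum1_card leq_eqVlt; apply/orP; left; apply/eqP/eq_bigl => y; rewrite inE.
have Y0 := none ord0; have := none (lift ord0 ord0); have := none (lift ord0 (lift ord0 ord0)).
rewrite !big_ord_recl big_ord0 addn0 -(ler_nat R) !natrD.
lra.
Qed.

End NearPhase.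

(** * Colourings that agree outside a sparse set *)

Section ClassBound.
Variables (T : finType) (e : rel T) (d : nat).
Hypotheses (esym : symmetric e) (eirr : irreflexive e).
Hypotheses (ereg : regular_graph e d) (d_gt0 : (0 < d)%N).
Variables (E O : {set T}).
Hypothesis bip : bipartition e E O.

(** As [F :\: W] spans no edge, every edge inside [F] can be charged to an end in [W]: to its end in
    [E] if that lies in [W], and to its other end if not. *)
Lemma internal_edges (F W : {set T}) (D : nat) :
  W \subset F -> no_edge e (F :\: W) (F :\: W) ->
  (forall v, v \in F -> (#|nbhd e v :&: F| <= D)%N) ->
  (\sum_(x in F :&: E) #|nbhd e x :&: F| <= #|W| * D)%N.
Proof.
move=> WF noe FD; have bip' := bipartitionC bip.
rewrite (bigID (mem W)) /= -(cardsID E W) mulnDl; apply: leq_add.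
  rewrite -sum_nat_const (eq_bigl (fun x => x \in W :&: E)); last first.
    move=> x; rewrite !inE; case xW: (x \in W); rewrite ?andbF //=.
    by rewrite (subsetP WF _ xW) andbT.
  by apply: leq_sum => x; rewrite inE => /andP[xW _]; apply: FD; apply: (subsetP WF).
rewrite (eq_bigl (fun x => x \in (F :&: E) :\: W)); last first.
  by move=> x; rewrite !inE andbC.
rewrite (eq_bigr (fun x => #|nbhd e x :&: (W :\: E)|)); last first.
  move=> x; rewrite !inE => /and3P[xW xF xE]; apply: eq_card => y; rewrite !inE.
  case eyx : (e y x) => //=; have yE : y \notin E.
    by rewrite -(mem_bipartition _ bip) (bipartition_edge bip _ xE) // esym.
  rewrite yE; apply/idP/idP => [yF|]; last exact: (subsetP WF).
  apply: contraT => yW.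
  by have := noe y x; rewrite !inE yW yF xW xF eyx => /(_ isT isT).
rewrite (sum_degrees esym) -sum_nat_const; apply: leq_sum => y.
rewrite inE => /andP[yE yW]; apply: leq_trans (FD y (subsetP WF _ yW)).
by apply: subset_leq_card; apply/subsetP => x; rewrite !inE => /and3P[-> _ /andP[]].
Qed.

(** Of the edges leaving [F :&: E], those inside [F] are bounded by [internal_edges]; the others end
    in [O :\: F], which absorbs at most [d] per vertex. *)
Lemma free_set_bound (F W : {set T}) (D : nat) :
  W \subset F -> no_edge e (F :\: W) (F :\: W) ->
  (forall v, v \in F -> (#|nbhd e v :&: F| <= D)%N) ->
  (#|F| * d <= #|E| * d + #|W| * D)%N.
Proof.
move=> WF noe FD; have bip' := bipartitionC bip.
have := internal_edges WF noe FD; rewrite -(cardsID E F).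
have : (#|F :&: E| * d <=
        \sum_(x in F :&: E) #|nbhd e x :&: F| + \sum_(x in F :&: E) #|nbhd e x :&: (O :\: F)|)%N.
  rewrite -big_split -sum_nat_const; apply: leq_sum => x; rewrite inE => /andP[_ xE].
  rewrite /= -cardsUI -(ereg x); apply: leq_trans (leq_addr _ _).
  apply: subset_leq_card; apply/subsetP => y yx; move: (yx); rewrite !inE => -> /=.
  rewrite (bipartition_edge bip _ xE) ?andbT ?orbN //.
  by move: yx; rewrite inE esym.
have : (\sum_(x in F :&: E) #|nbhd e x :&: (O :\: F)| <= #|O :\: F| * d)%N.
  rewrite (sum_degrees esym) -sum_nat_const; apply: leq_sum => y _.
  by rewrite -(ereg y) subset_leq_card // subsetIl.
have := cardsID F O; have -> : O :&: F = F :\: E.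
  by apply/setP => x; rewrite !inE (mem_bipartition x bip) andbC.
rewrite (card_bipartition esym ereg d_gt0 bip).1; nia.
Qed.

Variables (R : realType) (delta : R).
Hypotheses (delta_ge0 : 0 <= delta) (delta_le1 : delta <= 1).
Hypothesis expd : forall A, expansion_test_set e E O A -> delta <= expansion_ratio e R A.

Lemma expd_swap A : expansion_test_set e O E A -> delta <= expansion_ratio e R A.
Proof. by case=> AEO sA A0; apply: expd; split=> //; rewrite orbC. Qed.

(** This is 3^5 = 243 <= 256 = 2^8. It prices a matched edge at 8/5 bits, against 2 bits for two
    unmatched vertices. *)
Lemma ln3_le : 5 * ln 3 <= 8 * ln 2 :> R.
Proof.
rewrite -[5]/(5%:R) -[8]/(8%:R) !mulr_natl -!lnXn ?ltr0n //.
by rewrite ler_ln ?posrE ?exprn_gt0 ?ltr0n // -!natrX ler_nat.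
Qed.

Lemma ln2_gt0 : 0 < ln 2 :> R.
Proof. by apply: ln_gt0; rewrite ltr1n. Qed.

(** [F] is where [C] is not constant, and [matching_bound] counts the choices there. If the
    unmatched part of [F] is almost an extremal independent set, [near_phase] makes a side almost
    monochromatic; otherwise few unmatched vertices or many matched edges give the saving. *)
Lemma class_bound (C : {set {ffun T -> 'I_3}}) (f0 : {ffun T -> 'I_3})
    (D : nat) (theta : R) :
  let F := [set v | [exists f in C, f v != f0 v]] in
  f0 \in C ->
  (forall f, f \in C -> proper_coloring e f) ->
  (forall v, v \in F -> exists2 w, e w v & w \notin F) ->
  (forall v, v \in F -> (#|nbhd e v :&: F| <= D)%N) ->
  (40 * D <= d)%N ->
  5 * theta <= #|E|%:R ->
  [\/ exists a, #|E|%:R - 4 * theta < #|color_class E f0 a|%:R,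
      exists a, #|E|%:R - 4 * theta < #|color_class O f0 a|%:R
    | ln #|C|%:R <= (#|E|%:R - delta * theta / 30) * ln 2].
Proof.
move=> F f0C prop outer FD D40 th5.
have bip' := bipartitionC bip.
have agree f w : f \in C -> w \notin F -> f w = f0 w.
  move=> fC; rewrite inE negb_exists => /forallP/(_ f).
  by rewrite fC negbK => /eqP.
(* The default [v] is never reached for [v] in [F], by [outer]. *)
pose c v := f0 (odflt v [pick w | e w v && (w \notin F)]).
have cE v : v \in F -> exists w, [/\ e w v, w \notin F & c v = f0 w].
  move=> vF; rewrite /c; case: pickP => [w /andP[ew wF]|h]; first by exists w.
  by have [w ew wF] := outer _ vF; have := h w; rewrite ew wF.
have edgeC f u v : f \in C -> e u v -> f u != f v.
  by move=> /prop/forallP/(_ u)/forallP/(_ v)/implyP; apply.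
have avoid f v : f \in C -> v \in F -> f v != c v.
  move=> fC /cE[w [ew wF ->]]; rewrite -(agree _ _ fC wF) eq_sym.
  exact: edgeC.
(* Two different fixed colours next to [v] would force the third one on [v] throughout [C], against
   [v \in F]. *)
have cuniq v w : v \in F -> e w v -> w \notin F -> f0 w = c v.
  move=> vF ew wF; apply/eqP/negPn/negP => ne.
  move: (vF); rewrite inE => /existsP[f /andP[fC]] /eqP; apply.
  apply: (third_color_unique ne); rewrite ?avoid // eq_sym ?edgeC //.
  by rewrite -(agree _ _ fC wF) edgeC.
have [m [k [W [WF Wm Fk noe le]]]] := matching_bound esym eirr prop avoid.
have leC : (#|C| <= 2 ^ k * 3 ^ m)%N.
  rewrite -nproj_full -(setUCr F); apply: (leq_trans (nprojU _ _ _)).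
  rewrite -[X in (_ <= X)%N]muln1 leq_mul // nproj_agree // => f g v fC gC.
  by rewrite inE => vF; rewrite !(agree _ v).
have Ck : ln #|C|%:R <= k%:R * ln 2 + m%:R * ln 3 :> R.
  have C0 : (0 < #|C|)%N by rewrite card_gt0; apply/set0Pn; exists f0.
  rewrite !mulr_natl -!lnXn ?ltr0n // -lnM ?posrE ?exprn_gt0 ?ltr0n //.
  by rewrite ler_ln ?posrE ?mulr_gt0 ?exprn_gt0 ?ltr0n // -!natrX -natrM ler_nat.
(* With [D] <= [d]/40 and [#|W|] = 2[m], the excess [#|W| * D] / [d] in [free_set_bound] is at most
   [m]/20. *)
have Fb : 20 * (k%:R + 2 * m%:R) <= 20 * #|E|%:R + m%:R :> R.
  rewrite -!natrM -!natrD -natrM ler_nat -(leq_pmul2r d_gt0).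
  by have := free_set_bound WF noe FD; rewrite Wm Fk; nia.
pose X := (F :\: W) :&: E; pose Y := (F :\: W) :&: O.
have XE : X \subset E := subsetIr _ _.
have YO : Y \subset O := subsetIr _ _.
have XY : no_edge e X Y.
  by move=> x y /setIP[xI _] /setIP[yI _]; apply: noe.
have cXY : #|X|%:R + #|Y|%:R = k%:R :> R.
  rewrite -natrD; congr (_ %:R); have := cardsID E (F :\: W).
  have -> : (F :\: W) :\: E = Y.
    by apply/setP => x; rewrite !inE (mem_bipartition x bip) andbC.
  by rewrite -/X => ->; rewrite cardsD (setIidPr WF) Wm Fk addnK.
have cover x y : y \in F :\: W -> e x y -> x \in W \/ f0 x = c y.
  move=> yI exy; case xW : (x \in W); [by left|right].
  apply: cuniq => //; first by move: yI; rewrite inE => /andP[].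
  apply/negP => xF; have xI : x \in F :\: W by rewrite inE xW xF.
  by move/negP: (noe _ _ xI yI).
have XYn := independent_bound esym ereg d_gt0 bip delta_ge0 expd XE YO XY.
have [small|big] := ltP (#|E|%:R - #|X|%:R - #|Y|%:R + 2 * #|W|%:R) (delta * theta).
  have w0 : 0 <= #|W|%:R :> R by rewrite ler0n.
  have : Num.min #|X|%:R #|Y|%:R < theta.
    rewrite ltNge; apply/negP => h.
    have : delta * theta <= delta * Num.min #|X|%:R #|Y|%:R by rewrite ler_wpM2l.
    lra.
  rewrite gt_min => /orP[Xth|Yth].
    constructor 1.
    apply: (near_phase esym ereg d_gt0 bip delta_ge0 delta_le1 expd XE YO XY
             (W := W) (c := c)) => // x y.
    by rewrite inE => /andP[yI _]; apply: cover.
  constructor 2; have eqEO := (card_bipartition esym ereg d_gt0 bip).1.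
  rewrite -eqEO.
  apply: (near_phase esym ereg d_gt0 bip' delta_ge0 delta_le1 expd_swap YO XE (no_edgeC esym XY)
             (W := W) (c := c)) => //.
  - by move=> x y; rewrite inE => /andP[yI _]; apply: cover.
  - by rewrite eqEO.
  - by rewrite eqEO; lra.
constructor 3; apply: (le_trans Ck).
have m3 : m%:R * ln 3 <= m%:R * (8 / 5 * ln 2) :> R.
  by rewrite ler_wpM2l ?ler0n //; have := ln3_le; lra.
apply: (@le_trans _ _ ((k%:R + 8 / 5 * m%:R) * ln 2)); first by lra.
rewrite ler_pM2r ?ln2_gt0 //.
(* Add 29/30 of [k] + 2[m] <= [#|E|] + [m]/20 to 1/30 of [k] <= [#|E|] + 4[m] - [delta * theta]:
   this gives the claim, with room to spare in the coefficient of [m]. *)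
have : #|W|%:R = 2 * m%:R :> R by rewrite Wm natrM.
have : 0 <= m%:R :> R by rewrite ler0n.
lra.
Qed.

End ClassBound.

(** * Certificates *)

(** The right side expands into the sum over all [g] of [q] to the number of agreements with [r]; a
    [g] in the ball has at least [#|T| - m] agreements. *)
Lemma hamming_ball (T A : finType) (r : T -> A) (q m : nat) : (0 < q)%N ->
  (#|[set g : {ffun T -> A} | #|[set v | g v != r v]| <= m]| * q ^ (#|T| - m)
     <= (q + #|A|.-1) ^ #|T|)%N.
Proof.
move=> q0; pose w v a := if a == r v then q else 1%N.
have -> : ((q + #|A|.-1) ^ #|T| = \prod_(v : T) \sum_(a : A) w v a)%N.
  rewrite -prod_nat_const; apply: eq_bigr => v _.
  rewrite (bigD1 (r v)) //= /w eqxx; congr addn.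
  rewrite (eq_bigr (fun=> 1%N)); last by move=> a /negbTE ->.
  by rewrite sum1_card cardC1.
rewrite bigA_distr_bigA -sum_nat_const big_mkcond; apply: leq_sum => g _.
case: ifP => //; rewrite inE => gm.
rewrite /w (bigID (fun v => g v == r v)) /=.
rewrite (eq_bigr (fun=> q)); last by move=> v ->.
rewrite (eq_bigr (fun=> 1%N) (P := fun v => g v != r v)); last by move=> v /negbTE ->.
rewrite !prod_nat_const exp1n muln1 leq_pexp2l //.
have := cardC (fun v => g v == r v).
have -> : #|[predC (fun v => g v == r v)]| = #|[set v | g v != r v]|.
  by rewrite cardsE; apply: eq_card.
have -> : #|(fun v => g v == r v)| = #|[pred v | g v == r v]| by apply: eq_card.
by move=> <-; rewrite leq_subLR addnC leq_add.
Qed.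

(** After division by [q ^ #|T|], apply 1 + x <= exp x with x = [#|A|.-1] / [q]. A larger [q]
    shrinks the second term at a logarithmic cost in the first. *)
Lemma hamming_ball_exp (R : realType) (T A : finType) (r : T -> A) (q m : nat) :
  (0 < q)%N ->
  #|[set g : {ffun T -> A} | #|[set v | g v != r v]| <= m]%N|%:R
    <= expR (m%:R * ln q%:R + #|A|.-1%:R * #|T|%:R / q%:R) :> R.
Proof.
move=> q0; set b := #|[set g | _]|; have qR : 0 < q%:R :> R by rewrite ltr0n.
have H : (b * q ^ #|T| <= (q + #|A|.-1) ^ #|T| * q ^ m)%N.
  apply: leq_trans (_ : b * q ^ (#|T| - m) * q ^ m <= _)%N.
    by rewrite -mulnA -expnD leq_mul // leq_pexp2l //; lia.
  by rewrite leq_mul2r hamming_ball ?orbT.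
rewrite expRD [_ * ln _]mulr_natl -lnXn // lnK ?posrE ?exprn_gt0 //.
rewrite mulrC (mulrAC _ #|T|%:R) expRM_natr.
have h1 : (1 + #|A|.-1%:R / q%:R) ^+ #|T| <= expR (#|A|.-1%:R / q%:R) ^+ #|T| :> R.
  by rewrite lerXn2r ?nnegrE ?expR_ge0 ?expR_ge1Dx // addr_ge0 ?divr_ge0 ?ler0n.
apply: (@le_trans _ _ ((1 + #|A|.-1%:R / q%:R) ^+ #|T| * q%:R ^+ m)); last first.
  by rewrite ler_wpM2r ?exprn_ge0 ?ler0n.
have -> : 1 + #|A|.-1%:R / q%:R = (q + #|A|.-1)%:R / q%:R :> R.
  by rewrite natrD; field; rewrite gt_eqF.
rewrite expr_div_n mulrAC ler_pdivlMr ?exprn_gt0 //.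
by rewrite -!natrX -!natrM ler_nat.
Qed.

(** * Greedy total domination *)

Section Domination.
Variables (T : finType) (e : rel T) (d : nat).
Hypotheses (esym : symmetric e) (ereg : regular_graph e d) (d_gt0 : (0 < d)%N).

Definition undominated (S : {set T}) : {set T} := [set v | nbhd e v :&: S == set0].

(** By double counting, an average vertex is adjacent to a fraction [d] / [#|T|] of the undominated
    vertices; adding a vertex at least that good shrinks their number by the factor 1 - [d] / [#|T|]
    or better. *)
Lemma greedy_domination (R : realType) (k : nat) : (0 < #|T|)%N ->
  exists2 S : {set T}, (#|S| <= k)%N &
    #|undominated S|%:R <= #|T|%:R * expR (- (k%:R * (d%:R / #|T|%:R))) :> R.
Proof.
move=> T0; have TR : 0 < #|T|%:R :> R by rewrite ltr0n.
elim: k => [|k [S Sk US]].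
  by exists set0; rewrite ?cards0 // mul0r oppr0 expR0 mulr1 ler_nat max_card.
have [v hv] : exists v, (d * #|undominated S| <= #|T| * #|nbhd e v :&: undominated S|)%N.
  apply/existsP; apply: contraT; rewrite negb_exists => /forallP h.
  have hsum : (\sum_(v in [set: T]) #|nbhd e v :&: undominated S| = d * #|undominated S|)%N.
    rewrite (sum_degrees esym) mulnC -sum_nat_const; apply: eq_bigr => u _.
    by rewrite setIT ereg.
  have : (\sum_(v in [set: T]) #|T| * #|nbhd e v :&: undominated S|
          < \sum_(v in [set: T]) d * #|undominated S|)%N.
    have [x _] : exists x : T, x \in T by apply/card_gt0P.
    rewrite (bigD1 x) ?inE //= [ltnRHS](bigD1 x) ?inE //=.
    rewrite -addSn; apply: leq_add; first by rewrite ltnNge h.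
    by apply: leq_sum => y _; rewrite ltnW // ltnNge h.
  by rewrite -big_distrr /= hsum sum_nat_const cardsT ltnn.
exists (v |: S); first by rewrite cardsU1; case: (v \notin S); rewrite ?add1n ?add0n // leqW.
have UE : undominated (v |: S) = undominated S :\: nbhd e v.
  apply/setP => u; rewrite !inE setIUr setU_eq0; congr andb.
  by rewrite setI_eq0 disjoint_sym disjoints1 inE esym.
have cU : (#|undominated (v |: S)| + #|nbhd e v :&: undominated S| = #|undominated S|)%N.
  by rewrite UE setIC addnC cardsID.
move: hv; rewrite -(ler_nat R) !natrM => hv.
move: cU => /(congr1 (fun k => k%:R : R)); rewrite natrD => cU.
have hU : #|undominated (v |: S)|%:R <= #|undominated S|%:R * (1 - d%:R / #|T|%:R) :> R.
  have -> : #|undominated S|%:R * (1 - d%:R / #|T|%:R)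
     = #|undominated S|%:R - d%:R * #|undominated S|%:R / #|T|%:R :> R.
    by field; rewrite gt_eqF.
  suff : d%:R * #|undominated S|%:R / #|T|%:R <= #|nbhd e v :&: undominated S|%:R :> R by lra.
  by rewrite ler_pdivrMr // mulrC [X in _ <= X]mulrC [X in X <= _]mulrC.
apply: (le_trans hU).
apply: (@le_trans _ _ (#|undominated S|%:R * expR (- (d%:R / #|T|%:R)))).
  by rewrite ler_wpM2l ?ler0n // (le_trans _ (expR_ge1Dx _)).
rewrite -natr1 mulrDl mul1r opprD expRD mulrA ler_wpM2r ?expR_ge0 //.
Qed.

Definition total_dominating (S : {set T}) := forall v, exists2 w, w \in S & e w v.

(** About [#|T|] ln [d] / [d] greedy steps leave at most [#|T|] / [d] undominated vertices, and one
    neighbour is added for each. Rounding up the number of steps costs 1 <= [#|T|] / [d], whence the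
    2. *)
Lemma exists_total_dominating (R : realType) : (0 < #|T|)%N ->
  exists2 S : {set T}, total_dominating S &
    #|S|%:R <= #|T|%:R * (ln d%:R + 2) / d%:R :> R.
Proof.
move=> T0; have TR : 0 < #|T|%:R :> R by rewrite ltr0n.
have dR : 0 < d%:R :> R by rewrite ltr0n.
have lnd0 : 0 <= ln d%:R :> R by rewrite ln_ge0 // ler1n.
set x : R := #|T|%:R * ln d%:R / d%:R.
have x0 : 0 <= x by rewrite divr_ge0 ?mulr_ge0 ?ler0n.
set k := (Num.truncn x).+1.
have [S Sk US] := greedy_domination R k T0.
have /andP[k1 k2] := truncn_itv x0.
have U : #|undominated S|%:R <= #|T|%:R / d%:R :> R.
  apply: (le_trans US); rewrite ler_pM2l // -(@lnK _ d%:R^-1) ?posrE ?invr_gt0 //.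
  rewrite ler_expR lnV ?posrE // lerN2.
  have -> : ln d%:R = x * (d%:R / #|T|%:R) :> R.
    by rewrite /x; field; rewrite !gt_eqF.
  by rewrite ler_wpM2r ?divr_ge0 ?ler0n // ltW.
have nbr u : exists w, e w u.
  have : (0 < #|nbhd e u|)%N by rewrite ereg.
  by rewrite card_gt0 => /set0Pn[w]; rewrite inE; exists w.
pose p u := odflt u [pick w | e w u].
exists (S :|: p @: undominated S).
  move=> v; have [vU|] := boolP (v \in undominated S).
    exists (p v); first by rewrite inE imset_f ?orbT.
    by rewrite /p; case: pickP => //= h; have [w] := nbr v; rewrite h.
  by rewrite inE => /set0Pn[w]; rewrite !inE => /andP[ewv wS]; exists w; rewrite // inE wS.
have cS : (#|S :|: p @: undominated S| <= k + #|undominated S|)%N.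
  apply: leq_trans (leq_card_setU _ _) _.
  by rewrite leq_add // leq_imset_card.
move: cS; rewrite -(ler_nat R) natrD => cS.
have kx : k%:R <= x + 1 by rewrite /k -natr1 lerD2r.
have Td : 1 <= #|T|%:R / d%:R :> R.
  rewrite ler_pdivlMr // mul1r ler_nat.
  by have /card_gt0P[u _] := T0; rewrite -(ereg u) max_card.
have -> : #|T|%:R * (ln d%:R + 2) / d%:R = x + 2 * (#|T|%:R / d%:R) :> R.
  by rewrite /x; field; rewrite gt_eqF.
lra.
Qed.

End Domination.

(** * Revealed sets *)

Section Revelation.
Variables (T : finType) (e : rel T).
Hypothesis esym : symmetric e.

Definition seen (f : {ffun T -> 'I_3}) (S : {set T}) (u : T) : {set 'I_3} :=
  f @: (nbhd e u :&: S).

Definition two_seen f S : {set T} := [set u | (1 < #|seen f S u|)%N].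

(* By maximality of [#|two_seen f S| - psi #|S|], one more revealed
   vertex cannot raise [#|two_seen|] by more than psi. *)
Definition revealed (S0 : {set T}) (psi : nat) (f : {ffun T -> 'I_3}) : {set T} :=
  [arg max_(S > S0 | S0 \subset S) (#|two_seen f S| + psi * (#|T| - #|S|))]%N.

(** Comparing the maximiser with [S0] bounds its size. Comparing it with [v |: S] gives the last
    bound, since every [u] counted there sees a second colour once [v] is revealed. *)
Lemma revealed_spec (S0 : {set T}) (psi : nat) (f : {ffun T -> 'I_3}) :
  let S := revealed S0 psi f in
  [/\ S0 \subset S, (psi * #|S| <= psi * #|S0| + #|T|)%N &
    forall v, v \notin S ->
      (#|[set u in nbhd e v | (#|seen f S u| == 1) && (f v \notin seen f S u)]| <= psi)%N].
Proof.
rewrite /revealed; case: arg_maxnP => [|S S0S Smax]; first exact: subxx.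
split=> // [|v vS].
  have := Smax S0 (subxx _); rewrite /geq /=.
  have : (#|two_seen f S| <= #|T|)%N by apply: max_card.
  have : (#|S| <= #|T|)%N by apply: max_card.
  have : (#|S0| <= #|T|)%N by apply: max_card.
  rewrite !mulnBr; move: #|two_seen f S0| => a; move: #|two_seen f S| => b.
  have h (k : nat) : (k <= #|T| -> psi * k <= psi * #|T|)%N.
    by move=> kT; rewrite leq_mul2l kT orbT.
  move=> /h + /h; move: (psi * #|S|)%N (psi * #|S0|)%N (psi * #|T|)%N => x y z.
  move: #|T| => t. lia.
set U := [set u in _ | _].
have := Smax (v |: S) (subset_trans S0S (subsetUr _ _)); rewrite /geq /=.
have cT : (#|v |: S| <= #|T|)%N by apply: max_card.
have : (#|U :|: two_seen f S| <= #|two_seen f (v |: S)|)%N.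
  apply: subset_leq_card; apply/subsetP => u; rewrite !inE => /orP[].
    case/and3P=> euv /eqP s1 fv.
    have : f v |: seen f S u \subset seen f (v |: S) u.
      rewrite subUset sub1set; apply/andP; split.
        by apply/imsetP; exists v => //; rewrite !inE eqxx -esym euv.
      by apply: imsetS; apply: setIS; apply: subsetUr.
    by move/subset_leq_card; rewrite cardsU1 fv s1.
  move=> h; apply: leq_trans h _; apply: subset_leq_card; apply: imsetS.
  by apply: setIS; apply: subsetUr.
rewrite cardsU disjoint_setI0 ?cards0 ?subn0; last first.
  rewrite disjoints_subset; apply/subsetP => u; rewrite !inE => /and3P[_ /eqP -> _].
  by [].
move: cT; rewrite cardsU1 vS /= add1n.
move: #|T| #|S| #|U| #|two_seen f S| => t s x y st.
rewrite -(subnSK st) mulnS; lia.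
Qed.

End Revelation.

(** * Counting by certificates *)

Section Counting.
Variables (T : finType) (e : rel T) (d : nat).
Hypotheses (esym : symmetric e) (eirr : irreflexive e).
Hypotheses (ereg : regular_graph e d) (d_gt0 : (0 < d)%N).
Variables (E O : {set T}).
Hypothesis bip : bipartition e E O.
Variables (R : realType) (delta : R).
Hypotheses (delta_ge0 : 0 <= delta) (delta_le1 : delta <= 1).
Hypothesis expd : forall A, expansion_test_set e E O A -> delta <= expansion_ratio e R A.

(** [None] marks the unrevealed vertices, so a certificate records both the revealed set and the
    colours on it. *)
Definition certificate (S0 : {set T}) (psi : nat) (f : {ffun T -> 'I_3}) :
    {ffun T -> option 'I_3} :=
  [ffun v => if v \in revealed e S0 psi f then Some (f v) else None].

Lemma certificate_inj_on S0 psi f g :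
  certificate S0 psi f = certificate S0 psi g ->
  revealed e S0 psi f = revealed e S0 psi g /\
  {in revealed e S0 psi f, f =1 g}.
Proof.
move=> /ffunP h; split=> [|v vR]; last first.
  by have := h v; rewrite !ffunE vR; case: ifP => // _ [].
by apply/setP => v; have := h v; rewrite !ffunE; case: ifP; case: ifP.
Qed.

(** A vertex [v] where [C] is not constant is unrevealed and, by domination, sees some colour; it
    sees only one, as two would force the third. For each colour [a] some [f] in [C] has [f v != a],
    and maximality of the revealed set of this [f] allows [v] at most [psi] neighbours that see only
    [a]. Three colours give the degree bound [3 * psi]. *)
Lemma certificate_class_bound (S0 : {set T}) (psi : nat) (theta : R)
    (C : {set {ffun T -> 'I_3}}) (f0 : {ffun T -> 'I_3}) :
  total_dominating e S0 ->
  (40 * (3 * psi) <= d)%N -> 5 * theta <= #|E|%:R ->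
  (forall f, f \in C -> proper_coloring e f) ->
  (forall f, f \in C -> certificate S0 psi f = certificate S0 psi f0) ->
  f0 \in C ->
  [\/ exists a, #|E|%:R - 4 * theta < #|color_class E f0 a|%:R,
      exists a, #|E|%:R - 4 * theta < #|color_class O f0 a|%:R
    | ln #|C|%:R <= (#|E|%:R - delta * theta / 30) * ln 2].
Proof.
move=> dom psid th5 prop same f0C.
pose S := revealed e S0 psi f0.
have sameS f : f \in C -> revealed e S0 psi f = S /\ {in S, f =1 f0}.
  by move=> fC; have [rf eqf] := certificate_inj_on (same f fC); rewrite /S -rf.
have [S0S _ _] := revealed_spec esym S0 psi f0.
have edgeC f u v : f \in C -> e u v -> f u != f v.
  by move=> /prop/forallP/(_ u)/forallP/(_ v)/implyP; apply.
set F := [set v | [exists f in C, f v != f0 v]].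
have FS v : v \in F -> v \notin S.
  rewrite inE => /existsP[f /andP[fC]]; apply: contraNN => vS.
  by apply/eqP; apply: (sameS _ fC).2.
have seenS f u : f \in C -> seen e f S u = seen e f0 S u.
  move=> fC; apply: eq_in_imset => w; rewrite inE => /andP[_ wS].
  exact: (sameS _ fC).2.
have notseen f u : f \in C -> f u \notin seen e f0 S u.
  move=> fC; rewrite -(seenS _ _ fC); apply/imsetP => -[w]; rewrite !inE => /andP[ewu _].
  by move/eqP; rewrite eq_sym; apply/negP/edgeC.
have seenF u : u \in F -> exists a, seen e f0 S u = [set a].
  move=> uF; have [w wS0 ewu] := dom u.
  exists (f0 w); apply/eqP; rewrite eqEsubset sub1set andbC imset_f /=; last first.
    by rewrite !inE ewu (subsetP S0S).
  apply/subsetP => b bs; rewrite inE eq_sym; apply: contraT => ne.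
  have as_ : f0 w \in seen e f0 S u by rewrite imset_f // !inE ewu (subsetP S0S).
  move: (uF); rewrite inE => /existsP[f /andP[fC] /eqP []].
  apply: (third_color_unique ne).
  - by apply: contraNneq (notseen f u fC) => ->.
  - by apply: contraNneq (notseen f u fC) => ->.
  - by apply: contraNneq (notseen f0 u f0C) => ->.
  - by apply: contraNneq (notseen f0 u f0C) => ->.
apply: (@class_bound _ _ d esym eirr ereg d_gt0 _ _ bip _ _ delta_ge0 delta_le1 expd
          C f0 (3 * psi)) => //.
  move=> v vF; have [w wS0 ewv] := dom v; exists w => //.
  by apply/negP => /FS; rewrite (subsetP S0S).
move=> v vF; pose Na a := [set u in nbhd e v | seen e f0 S u == [set a]].
have Na_le a : (#|Na a| <= psi)%N.
  have [f fC fva] : exists2 f, f \in C & f v != a.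
    have [->|ne] := eqVneq a (f0 v); last by exists f0; rewrite 1?eq_sym.
    by move: (vF); rewrite inE => /existsP[f /andP[fC ?]]; exists f.
  have [rf _] := sameS _ fC.
  have [_ _] := revealed_spec esym S0 psi f; rewrite rf => /(_ v (FS _ vF)).
  apply: leq_trans; apply: subset_leq_card; apply/subsetP => u.
  rewrite !inE => /andP[-> /eqP su] /=.
  by rewrite (seenS _ _ fC) su cards1 eqxx inE.
apply: (@leq_trans (\sum_(a : 'I_3) #|Na a|)); last first.
  by rewrite -[X in (_ <= X * _)%N](card_ord 3) -sum_nat_const; apply: leq_sum.
(* [k u] is the single colour seen by [u]; the default [ord0] is not reached on [F]. *)
pose k u := odflt ord0 [pick a | seen e f0 S u == [set a]].
rewrite -sum1_card (partition_big k predT) //=; apply: leq_sum => a _.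
rewrite -sum1_card [X in (_ <= X)%N]big_mkcond [X in (X <= _)%N]big_mkcond /=.
apply: leq_sum => u _.
case: ifP => // /andP[]; rewrite inE => /andP[uv uF] /eqP <-.
rewrite inE uv /k; have [b sb] := seenF _ uF.
by case: pickP => [b' /eqP ->|/(_ b)]; rewrite ?sb eqxx.
Qed.

(** Each fibre of the certificate map is bounded by [certificate_class_bound], whose two
    monochromatic cases are excluded on [B]. The certificates lie in a Hamming ball around the
    function equal to [None] everywhere. *)
Lemma off_phase_count (psi : nat) (theta : R) (B : {set {ffun T -> 'I_3}}) :
  (0 < #|T|)%N -> (0 < psi)%N ->
  (40 * (3 * psi) <= d)%N -> 5 * theta <= #|E|%:R ->
  (forall f, f \in B ->
     [/\ proper_coloring e f,
       forall a, #|color_class E f a|%:R <= #|E|%:R - 4 * theta &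
       forall a, #|color_class O f a|%:R <= #|E|%:R - 4 * theta]) ->
  #|B|%:R <= expR (#|T|%:R * ((ln d%:R + 2) / d%:R + 1 / psi%:R) * ln d%:R
                   + 3 * #|T|%:R / d%:R + (#|E|%:R - delta * theta / 30) * ln 2).
Proof.
move=> T0 psi0 psid th5 HB; have psiR : 0 < psi%:R :> R by rewrite ltr0n.
have [S0 dom S0le] := exists_total_dominating esym ereg d_gt0 R T0.
pose cert := certificate S0 psi; pose M := expR ((#|E|%:R - delta * theta / 30) * ln 2).
have fiber g : g \in cert @: B -> #|[set f in B | cert f == g]|%:R <= M.
  case/imsetP=> f0 f0B ->; set C := [set f in B | _].
  have f0C : f0 \in C by rewrite inE f0B eqxx.
  have CB f : f \in C -> f \in B by rewrite inE => /andP[].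
  have [_ hE hO] := HB _ f0B.
  have [||[a]|[a]|] := @certificate_class_bound S0 psi theta C f0 dom psid th5 _ _ f0C.
  - by move=> f /CB/HB[].
  - by move=> f; rewrite inE => /andP[_ /eqP].
  - by have := hE a; lra.
  - by have := hO a; lra.
  - rewrite -ler_expR lnK // posrE ltr0n card_gt0; apply/set0Pn; by exists f0.
pose m := (#|S0| + Num.truncn (#|T|%:R / psi%:R : R))%N.
have certm f : (#|[set v | cert f v != None]| <= m)%N.
  have -> : [set v | cert f v != None] = revealed e S0 psi f.
    by apply/setP => v; rewrite !inE ffunE; case: ifP.
  have [S0S lS _] := revealed_spec esym S0 psi f.
  rewrite /m -leq_subLR truncn_ge_nat ?divr_ge0 ?ler0n //.
  rewrite ler_pdivlMr // -natrM ler_nat mulnC mulnBr leq_subLR //.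
have cB : (#|cert @: B| <= #|[set g : {ffun T -> option 'I_3} |
                              #|[set v | g v != None]| <= m]|)%N.
  apply: subset_leq_card; apply/subsetP => _ /imsetP[f _ ->].
  by rewrite inE certm.
(* Taking [q] = [d] costs ln [d] per revealed vertex; the 3 other values of [option 'I_3] yield the
   term 3 [#|T|] / [d]. *)
have ball := hamming_ball_exp R (fun _ : T => None : option 'I_3) m d_gt0.
rewrite card_option card_ord /= in ball.
have -> : #|B| = (\sum_(g in cert @: B) #|[set f in B | cert f == g]|)%N.
  rewrite -sum1_card (partition_big cert (mem (cert @: B))) /=; last first.
    by move=> f fB; apply: imset_f.
  apply: eq_bigr => g _; rewrite -sum1_card; apply: eq_bigl => f.
  by rewrite inE.
rewrite natr_sum; apply: (@le_trans _ _ (\sum_(g in cert @: B) M)).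
  by apply: ler_sum.
rewrite sumr_const -[M *+ _]mulr_natl expRD ler_wpM2r ?expR_ge0 //.
move: cB; rewrite -(ler_nat R) => /le_trans; apply; apply: (le_trans ball).
rewrite ler_expR lerD2r ler_wpM2r ?ln_ge0 ?ler1n //.
have tr : (Num.truncn (#|T|%:R / psi%:R : R))%:R <= #|T|%:R / psi%:R :> R.
  by rewrite truncn_le ?divr_ge0 ?ler0n.
rewrite /m natrD mulrDr mulrA mul1r; apply: lerD => //.
Qed.

End Counting.

(** * Conductance and Glauber dynamics *)

Section Bottleneck.
Variables (R : realType) (S : finType) (P : S -> S -> R).
Hypotheses (P_ge0 : forall x y, 0 <= P x y) (P_sym : forall x y, P x y = P y x).
Hypothesis P_row : forall x, \sum_y P x y = 1.
Variables (A B : {set S}).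
Hypothesis boundary : forall x y, x \in A -> y \notin A -> P x y != 0 -> x \in B.

Lemma iter_kernel_ge0 t x y : 0 <= iter_kernel P t x y.
Proof.
elim: t x => [|t IH] x /=; first by rewrite ler0n.
by apply: sumr_ge0 => z _; rewrite mulr_ge0.
Qed.

Lemma iter_kernel_row t x : \sum_y iter_kernel P t x y = 1.
Proof.
elim: t x => [|t IH] x /=.
  rewrite (bigD1 x) //= eqxx big1 ?addr0 // => y /negbTE.
  by rewrite eq_sym => ->.
rewrite exchange_big /= -[RHS](P_row x); apply: eq_bigr => z _.
by rewrite -mulr_sumr IH mulr1.
Qed.

Definition escape t x : R := \sum_(y | y \notin A) iter_kernel P t x y.

Lemma escape_ge0 t x : 0 <= escape t x.
Proof. by apply: sumr_ge0 => y _; apply: iter_kernel_ge0. Qed.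

Lemma escape_le1 t x : escape t x <= 1.
Proof.
rewrite -(iter_kernel_row t x) [leRHS](bigID (fun y => y \in A)) /= lerDr.
by apply: sumr_ge0 => y _; apply: iter_kernel_ge0.
Qed.

(** Condition on the first step from the counting measure on [A]. By symmetry it then has mass at
    most 1 at each point, so induction covers the part still in [A]; the part that crossed started
    in [B] and has mass at most [#|B|]. *)
Lemma sum_escape_le t : \sum_(x in A) escape t x <= t%:R * #|B|%:R.
Proof.
elim: t => [|t IH].
  rewrite mul0r big1 // => x xA; rewrite /escape big1 //= => y yA.
  by case: eqP => // xy; rewrite -xy xA in yA.
have -> : \sum_(x in A) escape t.+1 x = \sum_z (\sum_(x in A) P x z) * escape t z.
  under eq_bigr => x _.
    rewrite /escape /= exchange_big /=.
    under eq_bigr => z _ do rewrite -mulr_sumr -/(escape t z).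
    over.
  by rewrite exchange_big; apply: eq_bigr => z _; rewrite -mulr_suml.
have col z : \sum_(x in A) P x z <= 1.
  rewrite -(P_row z) [leRHS](bigID (fun y => y \in A)) /=.
  under eq_bigr do rewrite P_sym.
  by rewrite lerDl; apply: sumr_ge0.
have col0 z : 0 <= \sum_(x in A) P x z by apply: sumr_ge0.
rewrite (bigID (fun z => z \in A)) /= -natr1 mulrDl mul1r; apply: lerD.
  apply: le_trans IH; apply: ler_sum => z _.
  by rewrite ler_piMl ?escape_ge0.
apply: (@le_trans _ _ (\sum_(z | z \notin A) \sum_(x in A) P x z)).
  by apply: ler_sum => z _; rewrite ler_piMr ?escape_le1.
rewrite exchange_big /= -sum1_card natr_sum.
rewrite [leLHS](bigID (fun x => x \in B)) /= [X in _ + X]big1 ?addr0; last first.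
  move=> x /andP[xA xB]; apply: big1 => z zA.
  by apply: contraNeq xB; apply: boundary.
rewrite [leRHS](bigID (fun x => x \in A)) /=.
rewrite (eq_bigl (fun x => (x \in B) && (x \in A))); last by move=> x; rewrite andbC.
rewrite -[leLHS]addr0; apply: lerD; last by apply: sumr_ge0.
apply: ler_sum => x _; rewrite -(P_row x) [leRHS](bigID (fun y => y \in A)) /=.
by rewrite lerDr; apply: sumr_ge0.
Qed.

(** The discrepancy in the mass of [A] occurs again on the complement, which compensates the factor
    1/2. *)
Lemma dTV_ge_escape t x : x \in A ->
  1 - escape t x - #|A|%:R / #|S|%:R <= dTV P t (uniform_distr R (S := S)).
Proof.
move=> xA; rewrite /dTV; apply: (le_trans _ (le_bigmax _ _ x)) => /=.
have S0 : 0 < #|S|%:R :> R by rewrite ltr0n; apply/card_gt0P; exists x.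
have mass : \sum_(y in A) iter_kernel P t x y = 1 - escape t x.
  rewrite -(iter_kernel_row t x) [X in _ = X - _](bigID (fun y => y \in A)) /=.
  by rewrite addrK.
have muA : \sum_(y in A) uniform_distr R y = #|A|%:R / #|S|%:R :> R.
  by rewrite /uniform_distr sumr_const mulr_natl.
have muC : \sum_(y | y \notin A) uniform_distr R y = 1 - #|A|%:R / #|S|%:R :> R.
  have muT : \sum_(y : S) uniform_distr R y = 1 :> R.
    by rewrite /uniform_distr sumr_const cardT -cardE -[_ *+ _]mulr_natl mulfV ?gt_eqF.
  by rewrite -muA -muT [X in _ = X - _](bigID (fun y => y \in A)) /= addrAC subrr add0r.
have h1 : 1 - escape t x - #|A|%:R / #|S|%:R
    <= \sum_(y in A) `|iter_kernel P t x y - uniform_distr R y|.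
  by rewrite -mass -muA -sumrB; apply: ler_sum => y _; apply: ler_norm.
have h2 : 1 - #|A|%:R / #|S|%:R - escape t x
    <= \sum_(y | y \notin A) `|iter_kernel P t x y - uniform_distr R y|.
  rewrite -muC /escape -sumrB; apply: ler_sum => y _.
  by rewrite distrC; apply: ler_norm.
rewrite (bigID (fun y => y \in A)) /=; lra.
Qed.

(** Here e >= (1 + 1/4)^4 = 625/256 > 20/9. *)
Lemma expR1_inv_le : (expR 1)^-1 <= 9 / 20 :> R.
Proof.
have h : (5 / 4) ^+ 4 <= expR 1 :> R.
  have -> : 1 = 4%:R * (1 / 4) :> R by field.
  rewrite expRM_natl lerXn2r ?nnegrE ?expR_ge0 //; first by lra.
  by apply: le_trans (expR_ge1Dx _); lra.
rewrite -[leRHS]invrK lef_pV2 ?posrE ?expR_gt0 //; last by rewrite invr_gt0; lra.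
apply: le_trans h; lra.
Qed.

(** From every start in [A], the mass outside [A] at time [t] is at least 1 - 1/2 - 9/20 = 1/20;
    summing over [A] and applying [sum_escape_le] gives the bound. *)
Lemma bottleneck t : (2 * #|A| <= #|S|)%N ->
  dTV P t (uniform_distr R (S := S)) <= (expR 1)^-1 ->
  #|A|%:R <= 20 * t%:R * #|B|%:R :> R.
Proof.
move=> A2 mixed.
have esc x : x \in A -> 1 / 20 <= escape t x.
  move=> xA; have S0 : 0 < #|S|%:R :> R by rewrite ltr0n; apply/card_gt0P; exists x.
  have : #|A|%:R / #|S|%:R <= 1 / 2 :> R.
    by rewrite ler_pdivrMr //; move: A2; rewrite -(ler_nat R) natrM; lra.
  by have := dTV_ge_escape t xA; have := expR1_inv_le; lra.
have : \sum_(x in A) (1 / 20 : R) <= \sum_(x in A) escape t x by apply: ler_sum.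
rewrite sumr_const -mulr_natl; have := sum_escape_le t; lra.
Qed.

End Bottleneck.

(** * The Glauber kernel as a symmetric stochastic matrix *)

Section GlauberKernel.
Variables (R : realType) (T : finType) (e : rel T).

Lemma num_diffC (x y : coloring3 e) : num_diff x y = num_diff y x.
Proof. by apply: eq_card => v; rewrite !inE eq_sym. Qed.

Lemma glauber_sym (x y : coloring3 e) : glauber R x y = glauber R y x.
Proof.
rewrite /glauber eq_sym; case: eqP => [->//|_].
by rewrite /glauber_move num_diffC.
Qed.

Lemma glauber_move_ge0 (x y : coloring3 e) : 0 <= glauber_move R x y.
Proof. by rewrite /glauber_move; case: ifP; rewrite // invr_ge0 mulr_ge0 ?ler0n. Qed.

(** The changed vertex and its new colour determine a move, so there are at most 3 [#|T|] moves.
    This makes the holding probability nonnegative. *)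
Lemma sum_glauber_move (x : coloring3 e) :
  \sum_(y | y != x) glauber_move R x y <= 1.
Proof.
apply: (@le_trans _ _ (\sum_(y | num_diff x y == 1%N) (3 * #|T|%:R)^-1)).
  rewrite [leRHS]big_mkcond [leLHS]big_mkcond /=; apply: ler_sum => y _.
  by rewrite /glauber_move; case: ifP; case: ifP => // _ _; rewrite invr_ge0 mulr_ge0 ?ler0n.
rewrite sumr_const; set k := #|_|; rewrite -[_ *+ k]mulr_natl.
pose upd (p : T * 'I_3) := [ffun w => if w == p.1 then p.2 else val x w].
have kT : (k <= #|T| * 3)%N.
  rewrite -[X in (_ * X)%N](card_ord 3) -card_prod.
  rewrite -[k](card_imset (fun y => num_diff x y == 1%N) val_inj).
  apply: leq_trans (leq_imset_card upd predT).
  apply: subset_leq_card; apply/subsetP => _ /imsetP[y xy ->].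
  move: xy; rewrite unfold_in => /cards1P[v hv]; apply/imsetP; exists (v, val y v) => //.
  apply/ffunP => w; rewrite !ffunE /=; case: eqP => [->//|/eqP wv].
  apply/esym/eqP/negPn/negP => ne.
  have : w \in [set v | val x v != val y v] by rewrite inE.
  by rewrite hv inE (negbTE wv).
have [T0|T0] := posnP #|T|.
  by move: kT; rewrite T0 mul0n leqn0 => /eqP ->; rewrite mulr0n mul0r ler01.
rewrite ler_pdivrMr ?mulr_gt0 ?ltr0n // mul1r -natrM ler_nat.
by rewrite mulnC.
Qed.

Lemma glauber_ge0 (x y : coloring3 e) : 0 <= glauber R x y.
Proof.
rewrite /glauber; case: eqP => _; last exact: glauber_move_ge0.
by rewrite subr_ge0 sum_glauber_move.
Qed.

Lemma glauber_row (x : coloring3 e) : \sum_y glauber R x y = 1.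
Proof.
rewrite (bigD1 x) //= /glauber eqxx.
rewrite [X in _ + X](eq_bigr (glauber_move R x)) ?subrK // => y.
by rewrite eq_sym => /negbTE ->.
Qed.

Lemma glauber_neq0 (x y : coloring3 e) : x != y -> glauber R x y != 0 -> num_diff x y = 1%N.
Proof.
rewrite /glauber => /negbTE ->; rewrite /glauber_move.
by case: ifP => [/eqP->|_] //; rewrite eqxx.
Qed.

Lemma card_coloring3 (p : pred {ffun T -> 'I_3}) :
  #|[set x : coloring3 e | p (val x)]| = #|[set f | proper_coloring e f && p f]|.
Proof.
rewrite -[LHS](card_imset _ val_inj); apply: eq_card => f; rewrite inE.
apply/imsetP/andP => [[x] + ->|[pf pp]].
  by rewrite inE; split=> //; apply: valP.
by exists (exist _ f pf); rewrite ?inE.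
Qed.

End GlauberKernel.

(** * The boundary of a phase *)

Lemma ln2_ge (R : realType) : 1 / 2 <= ln 2 :> R.
Proof.
have := @le_ln1Dx R (- (1 / 2)); have -> : 1 - 1 / 2 = 2^-1 :> R by field.
by rewrite lnV ?posrE ?ltr0n //; lra.
Qed.

Lemma ln2_le1 (R : realType) : ln 2 <= 1 :> R.
Proof. by have := @le_ln1Dx R 1; rewrite (_ : 1 + 1 = 2) //; apply; lra. Qed.

Section ColorClasses.
Variables (T : finType) (E : {set T}).

Definition in_phase (a : 'I_3) (f : {ffun T -> 'I_3}) : bool :=
  (20 * #|E :\: color_class E f a| <= #|E|)%N.

Lemma color_class_sub f a : color_class E f a \subset E.
Proof. by apply/subsetP => x; rewrite inE => /andP[]. Qed.

Lemma card_off_color f a : (#|E :\: color_class E f a| + #|color_class E f a| = #|E|)%N.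
Proof. by rewrite addnC -[RHS](cardsID (color_class E f a)) (setIidPr (color_class_sub f a)). Qed.

Lemma color_class_other f a b :
  a != b -> color_class E f b \subset E :\: color_class E f a.
Proof.
move=> ab; apply/subsetP => x; rewrite !inE => /andP[-> /eqP ->].
by rewrite eq_sym ab.
Qed.

Lemma in_phase_disjoint (a b : 'I_3) f :
  (0 < #|E|)%N -> a != b -> in_phase a f -> ~~ in_phase b f.
Proof.
rewrite /in_phase => E0 ab ha; apply/negP => hb.
have := subset_leq_card (color_class_other f ab).
by have := card_off_color f b; lia.
Qed.

End ColorClasses.

Section Phases.
Variables (T : finType) (e : rel T) (d : nat).
Hypotheses (esym : symmetric e) (eirr : irreflexive e).
Hypotheses (ereg : regular_graph e d) (d_gt0 : (0 < d)%N).
Variables (E O : {set T}).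
Hypothesis bip : bipartition e E O.

(** By the last condition, one more vertex of another colour breaks the threshold of [in_phase];
    only from such colourings can a single move leave the phase. *)
Definition phase_boundary (a : 'I_3) : {set {ffun T -> 'I_3}} :=
  [set f | [&& proper_coloring e f, in_phase E a f &
            (#|E| < 20 * #|E :\: color_class E f a|.+1)%N]].

Definition ordered (a b : 'I_3) : {ffun T -> 'I_3} := [ffun v => if v \in E then a else b].

Definition frozen (a b : 'I_3) : {set {ffun T -> 'I_3}} :=
  [set f : {ffun T -> 'I_3} | #|[set v | f v != ordered a b v]| <= #|E| %/ 10]%N.

(** With [q] = 32 the exponent is at most (n/10) 5 ln 2 + 4n/32 for n = [#|E|], and n/8 <= (n/4) ln
    2. *)
Lemma frozen_count (R : realType) a b :
  #|frozen a b|%:R <= expR (3 / 4 * #|E|%:R * ln 2) :> R.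
Proof.
apply: (le_trans (hamming_ball_exp R (ordered a b) (#|E| %/ 10) (isT : 0 < 32)%N)).
rewrite ler_expR card_ord /= (card_bipartition esym ereg d_gt0 bip).2 natrM.
have -> : ln 32 = 5 * ln 2 :> R.
  by rewrite [RHS]mulr_natl -lnXn ?ltr0n // -natrX.
have m10 : 10 * (#|E| %/ 10)%:R <= #|E|%:R :> R.
  by rewrite -natrM ler_nat mulnC leq_trunc_div.
have l2 := ln2_ge R; have n0 : 0 <= #|E|%:R :> R by rewrite ler0n.
have : 10 * (#|E| %/ 10)%:R * ln 2 <= #|E|%:R * ln 2 :> R.
  by rewrite ler_wpM2r //; lra.
have : #|E|%:R * (1 / 2) <= #|E|%:R * ln 2 :> R by rewrite ler_wpM2l.
lra.
Qed.

(** Let n = [#|E|]. On [E], colour [a] misses more than n/20 - 1 >= n/25 vertices and any other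
    colour has at most n/20. On [O], colour [a] is confined to the at most n/20 vertices not
    adjacent to its class in [E]; another colour [b] misses more than n/10 - n/20 vertices, as [f]
    is not frozen. *)
Lemma boundary_off_phase (R : realType) (a : 'I_3) f : (100 <= #|E|)%N ->
  f \in phase_boundary a -> (forall b, f \notin frozen a b) ->
  [/\ proper_coloring e f,
     forall b, #|color_class E f b|%:R <= #|E|%:R - 4 * (#|E|%:R / 100) :> R &
     forall b, #|color_class O f b|%:R <= #|E|%:R - 4 * (#|E|%:R / 100) :> R].
Proof.
move=> n100; rewrite inE => /and3P[prop phE bdE] nfr.
have eqEO := (card_bipartition esym ereg d_gt0 bip).1.
have key k : (25 * k <= 24 * #|E|)%N -> k%:R <= #|E|%:R - 4 * (#|E|%:R / 100) :> R.
  by rewrite -(ler_nat R) !natrM; lra.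
have cE := card_off_color E f a; rewrite /in_phase in phE.
split=> // b; apply: key.
  have [<-|ab] := eqVneq a b.
    move: cE bdE n100 {phE}.
    move: #|E :\: color_class E f a| #|color_class E f a| #|E| => x y n; lia.
  move: (subset_leq_card (color_class_other E f ab)) phE {bdE cE}.
  by move: #|E :\: color_class E f a| #|color_class E f b| #|E| => x y n; lia.
have [<-|ab] := eqVneq a b.
  have OO : color_class O f a \subset O by apply/subsetP => x; rewrite inE => /andP[].
  have noe : no_edge e (color_class E f a) (color_class O f a).
    move=> x y; rewrite !inE => /andP[_ /eqP fx] /andP[_ /eqP fy]; apply/negP => exy.
    by move/forallP: prop => /(_ x)/forallP/(_ y); rewrite exy fx fy eqxx.
  have := no_edge_card esym ereg d_gt0 bip OO noe (color_class_sub E f a).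
  move: (card_nbhds_ge esym ereg (color_class E f a) d_gt0) cE phE {bdE}.
  move: #|E :\: _| #|color_class E f a| #|color_class O f a| #|E| #|nbhds _ _|.
  by move=> x y z n t; lia.
have := nfr b; rewrite inE -ltnNge => dist.
have sub : [set v | f v != ordered a b v]
    \subset (E :\: color_class E f a) :|: (O :\: color_class O f b).
  apply/subsetP => v; rewrite !inE ffunE (mem_bipartition v bip).
  by case: (v \in E) => /= ->.
have := leq_trans (subset_leq_card sub) (leq_card_setU _ _) => le1.
have := cardsID (color_class O f b) O.
rewrite (setIidPr _); last by apply/subsetP => x; rewrite inE => /andP[].
rewrite eqEO; move: dist; rewrite ltn_divLR //.
move: le1 phE {bdE cE}.
move: #|[set v | _]| #|E :\: _| #|O :\: _| #|color_class O f b| #|E| => s x y z n; lia.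
Qed.

(** Colour [E] by [a] and each vertex of [O] freely by one of the other two colours. *)
Lemma two_pow_le_in_phase (a : 'I_3) :
  (2 ^ #|E| <= #|[set x : coloring3 e | in_phase E a (val x)]|)%N.
Proof.
have eqEO := (card_bipartition esym ereg d_gt0 bip).1.
have [b /andP[ba _]] := exists_other_color a a.
have [c /andP[ca cb]] := exists_other_color a b.
pose h (B : {set T}) : {ffun T -> 'I_3} :=
  [ffun v => if v \in E then a else if v \in B then b else c].
rewrite card_coloring3 -eqEO -card_powerset.
have inj : {in powerset O &, injective h}.
  move=> B C; rewrite !inE => /subsetP BO /subsetP CO /ffunP hBC.
  apply/setP => v; have := hBC v; rewrite !ffunE; case vE : (v \in E).
    have vO : v \notin O by rewrite (mem_bipartition v bip) vE.
    by move=> _; rewrite (contraNF (BO v)) ?(contraNF (CO v)).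
  by case: (v \in B); case: (v \in C) => // bc; rewrite bc eqxx in cb.
rewrite -(card_in_imset inj); apply: subset_leq_card; apply/subsetP => _ /imsetP[B _ ->].
rewrite inE; apply/andP; split.
  apply/forallP => u; apply/forallP => v; apply/implyP => euv; rewrite !ffunE.
  have -> : (v \in E) = (u \notin E).
    apply/idP/idP => [vE|uE].
      by rewrite -(mem_bipartition u bip) (bipartition_edge bip _ vE) // esym.
    apply: (bipartition_edge (bipartitionC bip) euv).
    by rewrite (mem_bipartition u bip).
  case: (u \in E) => /=; last by case: ifP.
  by case: ifP; rewrite eq_sym.
rewrite /in_phase (_ : E :\: _ = set0) ?cards0 ?muln0 //.
by apply/setP => v; rewrite !inE ffunE; case: (v \in E); rewrite ?eqxx ?andbF.
Qed.

Lemma leave_phase (a : 'I_3) (x y : coloring3 e) :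
  in_phase E a (val x) -> ~~ in_phase E a (val y) -> num_diff x y = 1%N ->
  val x \in phase_boundary a.
Proof.
move=> xa ya xy; rewrite inE xa /=; apply/andP; split; first exact: valP.
apply: leq_trans (_ : _ < 20 * #|E :\: color_class E (val y) a|)%N _.
  by rewrite ltnNge.
rewrite leq_mul2l /= -[X in (_ <= X)%N]addn1 -[X in (_ <= _ + X)%N]xy.
apply: leq_trans (leq_card_setU _ _); apply: subset_leq_card.
apply/subsetP => v; rewrite !inE => /andP[+ vE]; rewrite vE /= !andbT => yva.
by have [->|_] := eqVneq (sval x v) (sval y v); rewrite ?yva ?orbT.
Qed.

End Phases.

(** The exponent of [off_phase_count] with [l] = ln 2, ln [d] = [L * l], 2[n] vertices and theta =
    [n]/100. Of the saving [delta * n]/3000 in bits, half pays for the certificates: each of their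
    costs is a bounded multiple of [delta / K]. *)
Lemma certificate_cost (R : realType) (n d L K delta psi l : R) :
  0 <= n -> 0 < d -> 0 < psi -> 1 / 2 <= l -> l <= 1 -> 1 <= L ->
  48 * 1000 <= K -> 0 < delta ->
  240 * K * L ^+ 3 <= delta * d -> K * L / delta < psi ->
  2 * n * ((L * l + 2) / d + 1 / psi) * (L * l) + 3 * (2 * n) / d
    + (n - delta * (n / 100) / 30) * l
  <= (n - delta * n / 6000) * l.
Proof.
move=> n0 d0 psi0 l1 l2 L1 K48 delta0 hd hpsi.
have K0 : 0 < K by apply: lt_le_trans K48; rewrite mulr_gt0 ?ltr0n.
have L0 : 0 < L by apply: lt_le_trans L1.
have L2 : 1 <= L ^+ 2 by rewrite exprn_ege1.
have LlL : L * l <= L by rewrite ler_piMr // ltW.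
have Ll0 : 0 <= L * l by rewrite mulr_ge0 ?ltW //; apply: lt_le_trans l1; rewrite divr_gt0.
have psiL : L / psi <= delta / K.
  rewrite ler_pdivrMr // mulrAC ler_pdivlMr // mulrC.
  by move: hpsi; rewrite ltr_pdivrMr // => /ltW; rewrite [psi * _]mulrC.
have L2d : 240 * (L ^+ 2 / d) <= delta / K.
  rewrite mulrA ler_pdivrMr // mulrAC ler_pdivlMr //.
  apply: le_trans hd; rewrite mulrAC ler_pM2l ?mulr_gt0 //.
  by rewrite [leRHS]exprSr ler_peMr // exprn_ge0 // ltW.
have dK : 48 * 1000 * (delta / K) <= delta.
  by rewrite mulrA ler_pdivrMr // mulrC ler_pM2l.
have d1 : d^-1 <= L ^+ 2 / d by rewrite ler_peMl // invr_ge0 ltW.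
have cost : ((L * l + 2) / d + 1 / psi) * (L * l) <= 3 * (L ^+ 2 / d) + L / psi.
  have -> : 3 * (L ^+ 2 / d) + L / psi = (3 * L / d + 1 / psi) * L.
    by field; rewrite !gt_eqF.
  apply: ler_pM => //.
    by rewrite addr_ge0 // divr_ge0 ?addr_ge0 // ltW.
  rewrite lerD2r ler_pM2r ?invr_gt0 //.
  by clear -LlL L1; lra.
have dl : delta * (1 / 2) <= delta * l by rewrite ler_pM2l.
have tot : 6000 * (2 * (((L * l + 2) / d + 1 / psi) * (L * l)) + 6 * d^-1) <= delta * l.
  move: d^-1 (_ * (L * l)) (L ^+ 2 / d) (L / psi) (delta / K) (delta * l)
    psiL L2d dK d1 cost dl delta0.
  by clear; move=> a b c x y z *; lra.
have : n * (6000 * (2 * (((L * l + 2) / d + 1 / psi) * (L * l)) + 6 * d^-1))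
    <= n * (delta * l) by rewrite ler_wpM2l.
move: d^-1 (1 / psi) => x y; clear; lra.
Qed.

(** Cancelling exponentials leaves exp [y] <= 80 [tau], where [y] is large enough for exp([y]/2) to
    absorb the 80. The target is the exponential of [y] / (4 [L]), at most [y]/2. *)
Lemma mixing_time_from_ratio (R : realType) (n delta L tau : R) :
  1 <= L -> 0 <= n -> 0 <= delta ->
  240 * (48 * 1000) <= delta * n ->
  expR (n * ln 2) <= 20 * tau * (4 * expR ((n - delta * n / 6000) * ln 2)) ->
  2 `^ (1 / (6000 * 8) * (2 * n) * delta / L) <= tau.
Proof.
move=> L1 n0 delta0 dn ratio; have l2 := ln2_ge R.
have L0 : 0 < L by apply: lt_le_trans L1.
set y := delta * n * ln 2 / 6000.
have y240 : 240 <= y.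
  have : 240 * (48 * 1000) * (1 / 2) <= delta * n * ln 2.
    by apply: ler_pM; rewrite ?divr_ge0 ?mulr_ge0 ?ler0n.
  by rewrite /y; clear; lra.
have ylow : expR y <= 80 * tau.
  have e0 : 0 < expR (n * ln 2 - y) by rewrite expR_gt0.
  rewrite -(ler_pM2l e0) -expRD subrK; apply: (le_trans ratio).
  have -> : (n - delta * n / 6000) * ln 2 = n * ln 2 - y by rewrite /y; field.
  by rewrite le_eqVlt; apply/orP; left; apply/eqP; ring.
rewrite /powR gt_eqF ?ltr0n //.
have -> : 1 / (6000 * 8) * (2 * n) * delta / L * ln 2 = y / 4 * L^-1.
  by rewrite /y; field; rewrite gt_eqF.
have y0 : 0 <= y by apply: le_trans y240; rewrite ler0n.
apply: (@le_trans _ _ (expR (y / 2))).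
  rewrite ler_expR; apply: (@le_trans _ _ (y / 4)).
    by rewrite ler_piMr ?invf_le1 // divr_ge0.
  by move: y y0 {y240 ylow} => y; clear; lra.
have h80 : 80 <= expR (y / 2).
  by apply: le_trans (expR_ge1Dx _); move: y y240 {ylow y0} => y; clear; lra.
have : expR (y / 2) * 80 <= expR (y / 2) * expR (y / 2).
  by rewrite ler_wpM2l ?expR_ge0.
by rewrite -expRD -splitr => /le_trans/(_ ylow); rewrite mulrC ler_pM2l ?ltr0n.
Qed.

Section BoundaryCount.
Variables (T : finType) (e : rel T) (d : nat).
Hypotheses (esym : symmetric e) (eirr : irreflexive e).
Hypotheses (ereg : regular_graph e d).
Variables (E O : {set T}).
Hypothesis bip : bipartition e E O.
Variables (R : realType) (delta K : R).
Hypotheses (delta_gt0 : 0 < delta) (delta_le1 : delta <= 1).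
Hypothesis expd : forall A, expansion_test_set e E O A -> delta <= expansion_ratio e R A.
Local Notation L := (log2 (d%:R : R)).
Hypotheses (K_ge : 48 * 1000 <= K) (L_ge1 : 1 <= L) (d_ge : (240 <= d)%N).
Hypotheses (n_ge : (100 <= #|E|)%N) (delta_ge : 240 * K * L ^+ 3 <= delta * d%:R).

Lemma phase_boundary_count (a : 'I_3) :
  #|phase_boundary e E a|%:R
    <= 4 * expR ((#|E|%:R - delta * #|E|%:R / 6000) * ln 2) :> R.
Proof.
have d_gt0 : (0 < d)%N by apply: leq_trans d_ge.
have dR : 0 < d%:R :> R by rewrite ltr0n.
have l2 := ln2_ge R; have l2' := ln2_le1 R.
have l20 : 0 < ln 2 :> R by lra.
have := (K_ge, L_ge1, delta_gt0) => -[[K_ge' L_ge1'] delta_gt0'].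
have K0 : 0 < K by lra.
have L0 : 0 < L by lra.
have n0 : 0 <= #|E|%:R :> R by rewrite ler0n.
have L2L : L <= L ^+ 2 by rewrite expr2 ler_peMr // ltW.
have L3L2 : L ^+ 2 <= L ^+ 3 by rewrite [leRHS]exprSr ler_peMr // exprn_ge0 // ltW.
have KL : 240 * (K * L) <= delta * d%:R.
  apply: le_trans delta_ge; rewrite -mulrA ler_pM2l // ler_pM2l //; lra.
set x := K * L / delta; have x0 : 0 < x by rewrite divr_gt0 // mulr_gt0.
have xd : 240 * x <= d%:R.
  by rewrite /x mulrA ler_pdivrMr // mulrC [leRHS]mulrC [leLHS]mulrC.
have /andP[psi1 psi2] := truncn_itv (ltW x0).
set psi := (Num.truncn x).+1 in psi2.
have psi_le : psi%:R <= x + 1 by rewrite /psi -natr1 lerD2r.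
have psi0 : 0 < psi%:R :> R by rewrite ltr0n.
(* Both 120 [x] and 120 are at most [d]/2, and [psi] <= [x] + 1. *)
have psid : (40 * (3 * psi) <= d)%N.
  rewrite -(ler_nat R) !natrM; move: d_ge; rewrite -(ler_nat R) => ?; lra.
have th5 : 5 * (#|E|%:R / 100) <= #|E|%:R :> R by lra.
have T0 : (0 < #|T|)%N by apply: leq_trans (max_card (mem E)); apply: leq_trans n_ge.
pose U := \bigcup_b frozen E a b.
have cU : #|U|%:R <= 3 * expR ((#|E|%:R - delta * #|E|%:R / 6000) * ln 2) :> R.
  have UF : (#|U| <= \sum_(b : 'I_3) #|frozen E a b|)%N.
    apply: (big_ind2 (fun (A : {set {ffun T -> 'I_3}}) k => #|A| <= k)%N).
    - by rewrite cards0.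
    - by move=> A k B l Ak Bl; apply: leq_trans (leq_card_setU _ _) (leq_add Ak Bl).
    - by [].
  apply: (@le_trans _ _ (\sum_(b : 'I_3) #|frozen E a b|%:R)).
    by rewrite -natr_sum ler_nat.
  apply: (@le_trans _ _ (\sum_(b : 'I_3) expR ((#|E|%:R - delta * #|E|%:R / 6000) * ln 2))).
    apply: ler_sum => b _; apply: le_trans (frozen_count esym ereg d_gt0 bip R a b) _.
    rewrite ler_expR ler_pM2r //.
    have : delta * #|E|%:R <= #|E|%:R by rewrite ler_piMl.
    lra.
  by rewrite sumr_const card_ord mulr_natl.
have off : #|phase_boundary e E a :\: U|%:R
    <= expR ((#|E|%:R - delta * #|E|%:R / 6000) * ln 2) :> R.
  have := @off_phase_count _ _ _ esym eirr ereg d_gt0 _ _ bip _ _ (ltW delta_gt0)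
    delta_le1 expd psi (#|E|%:R / 100) (phase_boundary e E a :\: U) T0 isT psid th5.
  have H f : f \in phase_boundary e E a :\: U ->
     [/\ proper_coloring e f,
     forall b, #|color_class E f b|%:R <= #|E|%:R - 4 * (#|E|%:R / 100) :> R &
     forall b, #|color_class O f b|%:R <= #|E|%:R - 4 * (#|E|%:R / 100) :> R].
    rewrite inE => /andP[fU fB]; apply: boundary_off_phase fB _ => // b.
    by apply: contraNN fU => fb; apply/bigcupP; exists b.
  move=> /(_ H) /le_trans; apply.
  rewrite ler_expR (card_bipartition esym ereg d_gt0 bip).2 natrM.
  have -> : ln d%:R = L * ln 2 by rewrite /log2 divfK // gt_eqF.
  exact: certificate_cost delta_ge psi2.
rewrite -(cardsID U) natrD.
have : #|phase_boundary e E a :&: U|%:R <= #|U|%:R :> R.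
  by rewrite ler_nat subset_leq_card // subsetIr.
move=> /le_trans/(_ cU) /lerD/(_ off) /le_trans; apply.
by rewrite le_eqVlt; apply/orP; left; apply/eqP; ring.
Qed.

End BoundaryCount.

Theorem corollary1p3 (R : realType) :
  exists d0 C1 C1' C2 : R,
    [/\ 0 < d0, 0 < C1, 0 < C1' & 0 < C2] /\
    forall (T : finType) (e : rel T) (E O : {set T}) (d l : nat) (delta : R),
      simple_graph e ->
      bipartition e E O ->
      regular_graph e d ->
      is_bipartite_expansion e E O delta ->
      is_locality e d l ->
      (0 < l)%N ->
      Num.max (C1 * log2 (d%:R : R) ^+ 3 / d%:R)
              (C1' * log2 (d%:R : R) / l%:R) <= delta ->
      d0 <= d%:R ->
      ergodic_chain (@glauber T e R) ->
      forall tau : nat,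
        is_mixing_time (@glauber T e R) (uniform_distr R (S := coloring3 e)) tau ->
        2 `^ (C2 * #|T|%:R * delta / log2 (d%:R : R)) <= tau%:R.
Proof.
have [K Kge] : exists K : R, 48 * 1000 <= K by exists (48 * 1000).
(* The 8 in the last constant combines [#|T|] = 2[#|E|] with the factor 4 in
   [mixing_time_from_ratio]. *)
exists 240, (240 * K), 1, (1 / (6000 * 8)); split; first by split; lra.
move=> T e E O d l delta [esym eirr] bip ereg [[A [AEO _ A0] dA] expd] _ _.
rewrite ge_max => /andP[hd _] d240 _ tau [mix _].
have dN : (240 <= d)%N by rewrite -(ler_nat R).
have d_gt0 : (0 < d)%N by apply: leq_trans dN.
have dR : 0 < d%:R :> R by rewrite ltr0n.
have l2 := ln2_ge R; have l2' := ln2_le1 R.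
have l20 : 0 < ln 2 :> R by lra.
set L := log2 (d%:R : R) in hd *.
have L1 : 1 <= L.
  rewrite /L /log2 ler_pdivlMr // mul1r ler_ln ?posrE ?ltr0n // ler_nat.
  exact: leq_trans dN.
have L31 : 1 <= L ^+ 3 by rewrite exprn_ege1.
have K0 : 0 < K by lra.
have hd' : 240 * K * L ^+ 3 <= delta * d%:R by rewrite -ler_pdivrMr.
have delta0 : 0 < delta.
  apply: lt_le_trans hd; rewrite divr_gt0 // mulr_gt0 ?exprn_gt0 //; lra.
(* The minimum is attained at [A], and no expansion ratio exceeds 1. *)
have delta1 : delta <= 1.
  have NA0 : 0 < #|nbhds e A|%:R :> R.
    rewrite ltr0n; apply: leq_trans (card_nbhds_ge esym ereg A d_gt0).
    by rewrite card_gt0.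
  by rewrite dA /expansion_ratio ler_pdivrMr // mul1r gerBl ler0n.
have [eqEO eqT] := card_bipartition esym ereg d_gt0 bip.
have E0 : (0 < #|E|)%N.
  have /set0Pn[x _] := A0.
  have : (0 < #|T|)%N by apply/card_gt0P; exists x.
  by rewrite eqT muln_gt0.
have dn := degree_le_side esym ereg d_gt0 bip E0.
have n100 : (100 <= #|E|)%N by apply: leq_trans dn; apply: leq_trans dN.
set n : R := #|E|%:R.
have nd : d%:R <= n by rewrite /n ler_nat.
pose S a : {set coloring3 e} := [set x | in_phase E a (val x)].
(* Two disjoint phases cannot both contain more than half of the colourings. *)
have [a halfS] : exists a, (2 * #|S a| <= #|{: coloring3 e}|)%N.
  have dis : [disjoint S ord0 & S ord_max].
    rewrite disjoints_subset; apply/subsetP => x; rewrite !inE.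
    by apply: in_phase_disjoint.
  have : (#|S ord0 :|: S ord_max| <= #|{: coloring3 e}|)%N by apply: max_card.
  rewrite cardsU disjoint_setI0 // cards0 subn0 => le.
  have [h|/ltnW h] := leqP #|S ord0| #|S ord_max|; [exists ord0|exists ord_max].
    by rewrite mul2n -addnn (leq_trans _ le) // leq_add2l.
  by rewrite mul2n -addnn (leq_trans _ le) // leq_add2r.
pose Bd : {set coloring3 e} := [set x | val x \in phase_boundary e E a].
have bdry x y : x \in S a -> y \notin S a -> glauber R x y != 0 -> x \in Bd.
  rewrite ![_ \in S a]inE [_ \in Bd]inE => xS yS Pxy.
  apply: (leave_phase xS yS); apply: (glauber_neq0 _ Pxy).
  by apply: contraNneq yS => <-.
have bot := bottleneck (@glauber_ge0 R T e) (@glauber_sym R T e) (@glauber_row R T e)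
  bdry halfS mix.
have cBd : #|Bd|%:R <= 4 * expR ((n - delta * n / 6000) * ln 2) :> R.
  apply: le_trans (phase_boundary_count esym eirr ereg bip delta0 delta1 expd Kge
    L1 dN n100 hd' a).
  rewrite ler_nat (card_coloring3 e (fun f => f \in phase_boundary e E a)).
  by apply: subset_leq_card; apply/subsetP => f; rewrite inE => /andP[].
have cS : expR (n * ln 2) <= #|S a|%:R.
  rewrite /n expRM_natl lnK ?posrE ?ltr0n // -natrX ler_nat.
  exact: (two_pow_le_in_phase esym ereg d_gt0 bip a).
(* A side has at least [d] vertices, so the lower bound on [delta * d] passes to [delta * n]. *)
have dn_big : 240 * K <= delta * n.
  apply: (@le_trans _ _ (delta * d%:R)); last by rewrite ler_pM2l.
  apply: le_trans hd'; rewrite ler_peMr //; lra.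
rewrite eqT natrM; apply: mixing_time_from_ratio => //.
- exact: ltW.
- by apply: le_trans dn_big; rewrite ler_pM2l.
apply: (le_trans cS); apply: (le_trans bot); rewrite ler_wpM2l //.
by rewrite mulr_ge0 ?ler0n.
Qed.
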